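(* Let $\Gamma\subseteq \mathrm{PSL}_2(\mathbb{R})$ be a geometrically finite Fuchsian group with at least one cusp, let $V$ be a finite-dimensional unitary space and let $\chi\colon\Gamma\to\mathrm{GL}(V)$ be a representation with non-expanding cusp monodromy. Let $\mathfrak{C}$ be a set containing exactly one representative of each cusp of $\Gamma$. For each $\mathfrak{c}\in\mathfrak{C}$ let $C_{\mathfrak{c}}>0$ be an admissible exponent at $\mathfrak{c}$ (as defined in the context). Set $C=\max_{\mathfrak{c}\in\mathfrak{C}}C_{\mathfrak{c}}$. Then the Eisenstein series $E_\chi$ with twist $\chi$ converges absolutely and compactly in $\mathbb{H}\times\{s\in\mathbb{C}:\operatorname{Re}s>1+C\}$.
   Context: $\mathbb{H}=\{z\in\mathbb{C}:\operatorname{Im}z>0\}$ is the upper half-plane, on which $\mathrm{PSL}_2(\mathbb{R})=\mathrm{SL}_2(\mathbb{R})/\{\pm \mathrm{id}\}$ acts by fractional linear transformations; the action extends to $\widehat{\mathbb{R}}=\mathbb{R}\cup\{\infty\}$. A Fuchsian group is a discrete subgroup $\Gamma$ of $\mathrm{PSL}_2(\mathbb{R})$; it is geometrically finite if it is finitely generated. An element of $\mathrm{PSL}_2(\mathbb{R})\setminus\{\mathrm{id}\}$ is parabolic if it fixes exactly one point of $\widehat{\mathbb{R}}$. A unitary space is a complex inner product space; $\mathrm{End}(V)$ is equipped with a fixed norm $\|\cdot\|$. The representation $\chi$ has non-expanding cusp monodromy if for every parabolic $p\in\Gamma$ all eigenvalues of $\chi(p)$ have modulus $1$. A cusp representative of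 $\Gamma$ is a point $\mathfrak{c}\in\widehat{\mathbb{R}}$ fixed by some parabolic element of $\Gamma$; the cusps of $\Gamma$ are the $\Gamma$-orbits of cusp representatives (finitely many, since $\Gamma$ is geometrically finite). For a cusp representative $\mathfrak{c}$ let $\Gamma_{\mathfrak{c}}=\{g\in\Gamma : g.\mathfrak{c}=\mathfrak{c}\}$, let $V_{\mathfrak{c}}=\{v\in V:\chi(p)v=v\ \text{for all } p\in\Gamma_{\mathfrak{c}}\}$, let $P_{\mathfrak{c}}\colon V\to V$ be the orthogonal projection onto $V_{\mathfrak{c}}$, and fix $\sigma_{\mathfrak{c}}\in\mathrm{PSL}_2(\mathbb{R})$ with $\sigma_{\mathfrak{c}}^{-1}.\mathfrak{c}=\infty$ and $\sigma_{\mathfrak{c}}^{-1}\Gamma_{\mathfrak{c}}\sigma_{\mathfrak{c}}=\left\{\begin{bmatrix}1&n\\0&1\end{bmatrix}:n\in\mathbb{Z}\right\}$. Admissible exponent: a real number $C_{\mathfrak{c}}>0$ is an admissible exponent at $\mathfrak{c}$ if there exist a continuous map $b\colon\mathbb{H}\to\mathbb{R}$ and, for every $z\in\mathbb{H}$, a finite set $H_e(z)\subseteq\Gamma_{\mathfrak{c}}\backslash\Gamma$, with $\bigcup_{z\in K}H_e(z)$ finite for every compact $K\subseteq\mathbb{H}$, such that for all $z\in\mathbb{H}$ and all $[g]\in\Gamma_{\mathfrak{c}}\backslash\Gamma$ with $[g]\notin H_e(z)$, $$\|\chi(g^{-1})P_{\mathfrak{c}}\|\le b(z)\,\bigl(\operatorname{Im}(\sigma_{\mathfrak{c}}^{-1}.z)\bigr)^{-\varepsilon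 C_{\mathfrak{c}}}\bigl(\operatorname{Im}(\sigma_{\mathfrak{c}}^{-1}g.z)\bigr)^{\varepsilon C_{\mathfrak{c}}},$$ where $\varepsilon=1$ if $\operatorname{Im}(\sigma_{\mathfrak{c}}^{-1}g.z)\ge\operatorname{Im}(\sigma_{\mathfrak{c}}^{-1}.z)$ and $\varepsilon=-1$ otherwise. The Eisenstein series at $\mathfrak{c}$ with twist $\chi$ is (formally) $$E_{\mathfrak{c},\chi}(z,s)=\sum_{[g]\in\Gamma_{\mathfrak{c}}\backslash\Gamma}\bigl(\operatorname{Im}(\sigma_{\mathfrak{c}}^{-1}g.z)\bigr)^s\,\chi(g^{-1})P_{\mathfrak{c}}\in\mathrm{End}(V),\qquad z\in\mathbb{H},\ s\in\mathbb{C},$$ and $E_\chi=\sum_{\mathfrak{c}\in\mathfrak{C}}E_{\mathfrak{c},\chi}$. ''Converges absolutely and compactly in $X$'' means that for every $\mathfrak c\in\mathfrak C$ the defining series of $E_{\mathfrak c,\chi}$ converges absolutely, and uniformly on every compact subset of $X$. *)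

(* Defs.v *)
From HB Require Import structures.
From mathcomp Require Import all_boot all_order all_algebra.
From mathcomp Require Import complex.
From mathcomp Require Import all_classical all_reals all_analysis.

Set Implicit Arguments.
Unset Strict Implicit.
Unset Printing Implicit Defensive.

Import Order.TTheory GRing.Theory Num.Theory.
Import numFieldNormedType.Exports.

Local Open Scope classical_set_scope.
Local Open Scope ring_scope.
Local Open Scope complex_scope.
Local Open Scope quotient_scope.

Section SL2.
Context (R : realType).

Definition SL2 := {A : 'M[R]_2 | \det A == 1}.

HB.instance Definition _ := SubChoice.on SL2.

(* SL_2(R) carries the subspace topology of R^4. *)
HB.instance Definition _ :=
  Topological.copy SL2 (initial_topology (val : SL2 -> 'M[R]_2)).

Definition mkSL2 (A : 'M[R]_2) (detA : \det A == 1) : SL2 :=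
  @exist _ (fun B : 'M[R]_2 => \det B == 1) A detA.

Fact SL2_one_subproof : \det (1%:M : 'M[R]_2) == 1.
Proof. by rewrite det1. Qed.

Fact SL2_mul_subproof (A B : SL2) : \det (val A *m val B) == 1.
Proof. by rewrite det_mulmx (eqP (valP A)) (eqP (valP B)) mulr1. Qed.

Fact SL2_inv_subproof (A : SL2) : \det (invmx (val A)) == 1.
Proof. by rewrite det_inv (eqP (valP A)) invr1. Qed.

Fact SL2_opp_subproof (A : SL2) : \det (- val A) == 1.
Proof. by rewrite -scaleN1r detZ (eqP (valP A)) mulr1 sqrrN expr1n. Qed.

Definition SL2_one : SL2 := mkSL2 SL2_one_subproof.
Definition SL2_mul (A B : SL2) : SL2 := mkSL2 (SL2_mul_subproof A B).
Definition SL2_inv (A : SL2) : SL2 := mkSL2 (SL2_inv_subproof A).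
Definition SL2_opp (A : SL2) : SL2 := mkSL2 (SL2_opp_subproof A).

Fact SL2_unitmx (A : SL2) : val A \in unitmx.
Proof. by rewrite unitmxE (eqP (valP A)) unitr1. Qed.

Fact SL2_mulA : associative SL2_mul.
Proof. by move=> A B C; apply: val_inj; rewrite /= mulmxA. Qed.

Fact SL2_mul1 : left_id SL2_one SL2_mul.
Proof. by move=> A; apply: val_inj; rewrite /= mul1mx. Qed.

Fact SL2_mulr1 : right_id SL2_one SL2_mul.
Proof. by move=> A; apply: val_inj; rewrite /= mulmx1. Qed.

Fact SL2_mulV : left_inverse SL2_one SL2_inv SL2_mul.
Proof. by move=> A; apply: val_inj; rewrite /= mulVmx ?SL2_unitmx. Qed.

Fact SL2_mulrV : right_inverse SL2_one SL2_inv SL2_mul.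
Proof. by move=> A; apply: val_inj; rewrite /= mulmxV ?SL2_unitmx. Qed.

HB.instance Definition _ :=
  isGroup.Build SL2 SL2_mulA SL2_mul1 SL2_mulr1 SL2_mulV SL2_mulrV.

Definition SL2_eqv (A B : SL2) : bool := (A == B) || (A == SL2_opp B).

Fact SL2_oppK : involutive SL2_opp.
Proof. by move=> A; apply: val_inj; rewrite /= opprK. Qed.

Fact SL2_eqv_refl : reflexive SL2_eqv.
Proof. by move=> A; rewrite /SL2_eqv eqxx. Qed.

Fact SL2_eqv_sym : symmetric SL2_eqv.
Proof.
move=> A B; rewrite /SL2_eqv eq_sym; congr (_ || _).
by rewrite -(inj_eq (inv_inj SL2_oppK)) SL2_oppK eq_sym.
Qed.

Fact SL2_eqv_trans : transitive SL2_eqv.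
Proof.
move=> B A C /orP[/eqP->//|/eqP->] /orP[/eqP->|/eqP->].
  by rewrite /SL2_eqv eqxx orbT.
by rewrite /SL2_eqv SL2_oppK eqxx.
Qed.

Canonical SL2_eqv_equiv :=
  EquivRel SL2_eqv SL2_eqv_refl SL2_eqv_sym SL2_eqv_trans.

Definition PSL2 := {eq_quot SL2_eqv_equiv}.

HB.instance Definition _ := Choice.on PSL2.
HB.instance Definition _ := EqQuotient.on PSL2.

Definition PSL2_one : PSL2 := \pi_PSL2 1%g.
Definition PSL2_mul (g h : PSL2) : PSL2 := \pi_PSL2 (repr g * repr h)%g.
Definition PSL2_inv (g : PSL2) : PSL2 := \pi_PSL2 (repr g)^-1%g.

Fact PSL2_piP (A B : SL2) :
  \pi_PSL2 A = \pi_PSL2 B <-> (A = B \/ A = SL2_opp B).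
Proof.
split=> [/eqmodP/orP[/eqP|/eqP]|[->//|AB]]; [by left|by right|].
by apply/eqmodP; rewrite /= /SL2_eqv AB eqxx orbT.
Qed.

Fact PSL2_reprP (A : SL2) :
  repr (\pi_PSL2 A) = A \/ repr (\pi_PSL2 A) = SL2_opp A.
Proof. by apply/PSL2_piP; rewrite reprK. Qed.

Fact PSL2_piM (A B : SL2) :
  PSL2_mul (\pi_PSL2 A) (\pi_PSL2 B) = \pi_PSL2 (A * B)%g.
Proof.
apply/PSL2_piP; have [->|->] := PSL2_reprP A; have [->|->] := PSL2_reprP B.
- by left.
- by right; apply: val_inj; rewrite /= mulmxN.
- by right; apply: val_inj; rewrite /= mulNmx.
- by left; apply: val_inj; rewrite /= mulNmx mulmxN opprK.
Qed.

Fact PSL2_piV (A : SL2) : PSL2_inv (\pi_PSL2 A) = \pi_PSL2 A^-1%g.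
Proof.
apply/PSL2_piP; have [->|->] := PSL2_reprP A; first by left.
right; apply: (@mulgI _ (SL2_opp A)); rewrite mulgV; apply: val_inj => /=.
by rewrite mulNmx mulmxN opprK mulmxV ?SL2_unitmx.
Qed.

Fact PSL2_piS (g : PSL2) : exists A : SL2, g = \pi_PSL2 A.
Proof. by exists (repr g); rewrite reprK. Qed.

Fact PSL2_mulA : associative PSL2_mul.
Proof.
move=> g h k; have [A ->] := PSL2_piS g; have [B ->] := PSL2_piS h.
by have [D ->] := PSL2_piS k; rewrite 4!PSL2_piM mulgA.
Qed.

Fact PSL2_mul1 : left_id PSL2_one PSL2_mul.
Proof. by move=> g; have [A ->] := PSL2_piS g; rewrite PSL2_piM mul1g. Qed.

Fact PSL2_mulr1 : right_id PSL2_one PSL2_mul.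
Proof. by move=> g; have [A ->] := PSL2_piS g; rewrite PSL2_piM mulg1. Qed.

Fact PSL2_mulV : left_inverse PSL2_one PSL2_inv PSL2_mul.
Proof.
by move=> g; have [A ->] := PSL2_piS g; rewrite PSL2_piV PSL2_piM mulVg.
Qed.

Fact PSL2_mulrV : right_inverse PSL2_one PSL2_inv PSL2_mul.
Proof.
by move=> g; have [A ->] := PSL2_piS g; rewrite PSL2_piV PSL2_piM mulgV.
Qed.

HB.instance Definition _ :=
  isGroup.Build PSL2 PSL2_mulA PSL2_mul1 PSL2_mulr1 PSL2_mulV PSL2_mulrV.

Definition mx22 (a b c d : R) : 'M[R]_2 :=
  \matrix_(i, j) if i == 0 then if j == 0 then a else b
                 else if j == 0 then c else d.

Fact unip_subproof (t : R) : \det (mx22 1 t 0 1) == 1.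
Proof.
rewrite (expand_det_col _ 0) big_ord_recl big_ord1 !mxE /= mul0r addr0 mul1r.
by rewrite /cofactor [row' _ _]mx11_scalar det_scalar1 !mxE /= expr0 mulr1.
Qed.

Definition unip (t : R) : PSL2 := \pi_PSL2 (mkSL2 (unip_subproof t)).

End SL2.

Section MoebiusAction.
Context (R : realType).

Definition uhp : set R[i]^o := [set z | 0 < complex.Im z].

Definition SL2_actC (A : SL2 R) (z : R[i]) : R[i] :=
  ((val A 0 0)%:C * z + (val A 0 1)%:C) / ((val A 1 0)%:C * z + (val A 1 1)%:C).

(* The extended real line; [None] is the point at infinity. *)
Definition Rhat := one_point_compactification R.

Definition SL2_actR (A : SL2 R) (x : Rhat) : Rhat :=
  let: (a, b, c, d) := (val A 0 0, val A 0 1, val A 1 0, val A 1 1) in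
  if x is Some t then
    if c * t + d == 0 then None else Some ((a * t + b) / (c * t + d))
  else if c == 0 then None else Some (a / c).

(* Both actions are insensitive to the sign of the representing matrix, see   *)
(* [actC_pi] and [actR_pi].                                                   *)
Definition actC (g : PSL2 R) (z : R[i]) : R[i] := SL2_actC (repr g) z.
Definition actR (g : PSL2 R) (x : Rhat) : Rhat := SL2_actR (repr g) x.

Lemma actC_pi (A : SL2 R) z : actC (\pi_(PSL2 R) A) z = SL2_actC A z.
Proof.
rewrite /actC; have [->//|->] := PSL2_reprP A.
by rewrite /SL2_actC /= !mxE !rmorphN/= !mulNr -!opprD invrN mulrNN.
Qed.

Lemma actR_pi (A : SL2 R) x : actR (\pi_(PSL2 R) A) x = SL2_actR A x.
Proof.
rewrite /actR; have [->//|->] := PSL2_reprP A.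
rewrite /SL2_actR /= !mxE; case: x => [t|].
  by rewrite !mulNr -!opprD oppr_eq0 invrN mulrNN.
by rewrite oppr_eq0 invrN mulrNN.
Qed.

End MoebiusAction.

Section Fuchsian.
Context (R : realType).
Implicit Types (G : set (PSL2 R)) (c : Rhat R).

Definition discrete_set (T : topologicalType) (A : set T) : Prop :=
  A `<=` isolated A.

Definition subgroup (gT : groupType) (G : set gT) : Prop :=
  group_closed (mem G).

(* PSL_2(R) carries the quotient topology of SL_2(R). *)
Definition fuchsian G : Prop :=
  subgroup G /\ discrete_set (G : set (quotient_topology (PSL2 R))).

Definition finitely_generated (gT : groupType) (G : set gT) : Prop :=
  exists2 S : set gT, finite_set S & G = smallest (@subgroup gT) S.

Definition geometrically_finite G : Prop := finitely_generated G.

Definition parabolic (p : PSL2 R) : Prop :=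
  p <> 1%g /\ exists! x : Rhat R, actR p x = x.

Definition cusp_rep G : set (Rhat R) :=
  [set c | exists p, [/\ G p, parabolic p & actR p c = c]].

(* [CC] contains exactly one point of each G-orbit of cusp representatives.   *)
Definition cusp_transversal G (CC : set (Rhat R)) : Prop :=
  CC `<=` cusp_rep G /\
  forall c, cusp_rep G c ->
    exists! c', CC c' /\ exists2 g, G g & actR g c = c'.

Definition stab G c : set (PSL2 R) := [set g | G g /\ actR g c = c].

Definition cusp_scaling G c (sigma : PSL2 R) : Prop :=
  actR sigma^-1%g c = None /\
  [set (sigma^-1 * g * sigma)%g | g in stab G c] =
  [set unip (n%:~R) | n in [set: int]].

End Fuchsian.

Section Cosets.
Context (gT : groupType).
Implicit Types (H G : set gT).

(* The coset H g, as an element of the quotient H \ G. *)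
Definition right_coset H (g : gT) : set gT := [set (h * g)%g | h in H].

Definition coset_space H G : set (set gT) := [set right_coset H g | g in G].

Definition coset_repr (A : set gT) : gT := xget 1%g A.

End Cosets.

Section Representation.
Context (R : realType) (V : vectType R[i]).
Implicit Types (G : set (PSL2 R)) (chi : PSL2 R -> 'End(V)) (c : Rhat R).

(* A representation G -> GL(V), given as a total function whose values        *)
(* outside G are irrelevant; these equations make chi g invertible, with      *)
(* inverse chi g^-1, for g in G.                                              *)
Definition representation G chi : Prop :=
  chi 1%g = \1%VF /\
  forall g h, G g -> G h -> chi (g * h)%g = (chi g \o chi h)%VF.

Definition nonexpanding_cusp_monodromy G chi : Prop :=
  forall p, G p -> parabolic p ->
  forall a : R[i], passmx.leigenvalue (chi p) a -> `|a| = 1.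

Definition cusp_fixed G chi c : set V :=
  [set v | forall p, stab G c p -> chi p v = v].

Definition orthogonal_projection (dot : {dot V for Num.conj}) (W : set V)
    (P : 'End(V)) : Prop :=
  forall v, W (P v) /\ forall w, W w -> dot (v - P v) w = 0.

End Representation.

Definition is_norm (R : realType) (U : lmodType R[i]) (N : U -> R) : Prop :=
  [/\ forall u v, N (u + v) <= N u + N v,
      forall (a : R[i]) u, N (a *: u) = Normc.normc a * N u &
      forall u, N u = 0 -> u = 0].

Section Eisenstein.
Context (R : realType) (V : vectType R[i]).
Implicit Types (G : set (PSL2 R)) (chi : PSL2 R -> 'End(V)) (c : Rhat R)
  (sigma : PSL2 R) (P : 'End(V)) (N : 'End(V) -> R).

Definition admissible_exponent N G chi c sigma P (C : R) : Prop :=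
  0 < C /\
  exists (b : R[i]^o -> R) (He : R[i]^o -> set (set (PSL2 R))),
  [/\ {within @uhp R, continuous b},
      forall z, uhp z ->
        finite_set (He z) /\ He z `<=` coset_space (stab G c) G,
      forall K : set R[i]^o, compact K -> K `<=` @uhp R ->
        finite_set (\bigcup_(z in K) He z) &
      forall z, uhp z -> forall g, G g -> ~ He z (right_coset (stab G c) g) ->
        let y0 := complex.Im (actC sigma^-1%g z) in
        let y1 := complex.Im (actC (sigma^-1 * g)%g z) in
        let e : R := if y0 <= y1 then 1 else -1 in
        N (chi g^-1%g \o P)%VF <= b z * y0 `^ (- (e * C)) * y1 `^ (e * C)].

(* y^s = exp(s ln y) for y > 0 and complex s. *)
Definition cpow (y : R) (s : R[i]) : R[i] :=
  (y `^ complex.Re s)%:C *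
  (cos (complex.Im s * ln y) +i* sin (complex.Im s * ln y)).

(* The summand depends only on the coset stab G c * g when P maps into        *)
(* [cusp_fixed G chi c].                                                      *)
Definition eisenstein_summand chi sigma P (g : PSL2 R) (zs : R[i]^o * R[i]^o)
    : 'End(V) :=
  cpow (complex.Im (actC (sigma^-1 * g)%g zs.1)) zs.2 *: (chi g^-1%g \o P)%VF.

Definition eisenstein_term chi sigma P (A : set (PSL2 R)) :=
  eisenstein_summand chi sigma P (coset_repr A).

End Eisenstein.

(* Summation over D is unordered: finite partial sums are compared along the  *)
(* net of finite subsets of D, uniformly on K.                                *)
Definition unif_summable_on (R : realType) (I : choiceType) (T : Type)
    (U : zmodType) (N : U -> R) (D : set I) (f : I -> T -> U) (S : T -> U)
    (K : set T) : Prop :=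
  forall e : R, 0 < e ->
  exists2 F0 : set I, finite_set F0 /\ F0 `<=` D &
  forall F, finite_set F -> F0 `<=` F -> F `<=` D ->
  forall x, K x -> N (S x - \sum_(i \in F) f i x) < e.

Definition cvg_absolutely_compactly (R : realType) (I : choiceType)
    (T : topologicalType) (U : zmodType) (N : U -> R) (D : set I)
    (f : I -> T -> U) (X : set T) : Prop :=
  (forall x, X x -> summable D (fun i => (N (f i x))%:E)) /\
  exists S : T -> U, forall K, compact K -> K `<=` X ->
    unif_summable_on N D f S K.

Definition is_max (R : realType) (A : set R) (m : R) : Prop := A m /\ ubound A m.

(* Main.v *)
(** On a compact set all but finitely many summands are bounded, through the
    admissible exponent, by a constant times Im(sigma^-1 g.z)^(Re s +- C_c), so
    everything reduces to the untwisted series with real exponent alpha > 1.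
    If (c, d) is the bottom row of sigma^-1 g, then Im(sigma^-1 g.z) is
    comparable to 1 / (c^2 + d^2), locally uniformly in z. Discreteness forces
    c^2 + d^2 >= delta for some delta > 0 and, by a packing argument (translate
    sigma^-1 g so that the real part of its value at i lies in [0, 1), and cut
    the possible matrices into small boxes), leaves only O(4^k) cosets with
    c^2 + d^2 ~ delta 4^k. The series is thus dominated by the geometric series
    of ratio 4^(1 - alpha), and the Weierstrass M-test applies; the limit is
    built coordinatewise, all norms on End(V) being equivalent. *)

Require Import Defs.
From HB Require Import structures.
From mathcomp Require Import all_boot all_order all_algebra.
From mathcomp Require Import complex.
From mathcomp Require Import all_classical all_reals all_analysis.
From mathcomp Require Import ring lra.

Set Implicit Arguments.
Unset Strict Implicit.
Unset Printing Implicit Defensive.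

Import Order.TTheory GRing.Theory Num.Theory.
Import numFieldNormedType.Exports.

Local Open Scope classical_set_scope.
Local Open Scope ring_scope.

(** * Weierstrass M-test for nets in a finite-dimensional space *)

Section FiniteSums.
Context {R : realType} {I : choiceType}.
Implicit Types (D A B F G : set I) (a b m : I -> R).

Lemma ler_fsumr F a b : finite_set F -> (forall i, F i -> a i <= b i) ->
  \sum_(i \in F) a i <= \sum_(i \in F) b i.
Proof.
move=> finF ab; rewrite !fsbig_finite //= big_seq_cond [leRHS]big_seq_cond.
apply: ler_sum => i; rewrite andbT in_fset_set // inE; exact: ab.
Qed.

Lemma ler_fsumr_subset A B a : finite_set B -> A `<=` B ->
  (forall i, 0 <= a i) -> \sum_(i \in A) a i <= \sum_(i \in B) a i.
Proof.
move=> finB AB a0; rewrite (fsbigID A B) // setIidr //= lerDl.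
exact: fsumr_ge0.
Qed.

(** The limit along finite subsets of [D] when [a] is nonnegative with bounded finite sums. With
    mixed signs a supremum need not be a limit, hence [real_net_sum] further on. *)
Definition net_sum D a : R := sup [set \sum_(i \in F) a i | F in fsets D].

(** A competing finite [G] splits into its part inside [F], which costs at most the sum over [F],
    and its part outside [F], which misses [F0] and costs at most [e]. *)
Lemma net_sum_tail D a (e : R) F0 : (forall i, 0 <= a i) ->
  finite_set F0 -> F0 `<=` D ->
  (forall G, finite_set G -> G `<=` D -> G `&` F0 = set0 ->
     \sum_(i \in G) a i <= e) ->
  forall F, finite_set F -> F0 `<=` F -> F `<=` D ->
    0 <= net_sum D a - \sum_(i \in F) a i <= e.
Proof.
move=> a0 finF0 F0D tail F finF F0F FD.
have ub : ubound [set \sum_(i \in G) a i | G in fsets D]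
    (\sum_(i \in F) a i + e).
  move=> _ [G [finG GD] <-].
  rewrite (fsbigID F G) //=; apply: lerD.
    exact: ler_fsumr_subset.
  apply: tail; first exact: finite_setIl.
    by move=> i [/GD].
  by rewrite -subset0 => i [[_ nFi] /F0F].
rewrite subr_ge0 lerBlDl; apply/andP; split.
  by apply: ub_le_sup; [exists (\sum_(i \in F) a i + e) | exists F].
by apply: ge_sup => //; exists (\sum_(i \in F) a i); exists F.
Qed.

(** Cauchy criterion: some [F] has sum within [e] of the supremum, so a set disjoint from it can add
    at most [e]. [F0] also absorbs the exceptional indices [A], so that no tail meets them. *)
Lemma bounded_fsumr_tail D m (B : R) A (e : R) : (forall i, 0 <= m i) ->
  (forall F, finite_set F -> F `<=` D -> \sum_(i \in F) m i <= B) ->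
  0 < e -> finite_set A ->
  exists F0, [/\ finite_set F0, F0 `<=` D, A `&` D `<=` F0 &
    forall G, finite_set G -> G `<=` D -> G `&` F0 = set0 ->
      \sum_(i \in G) m i <= e].
Proof.
move=> m0 mB e0 finA.
pose X := [set \sum_(i \in F) m i | F in fsets D].
have supX : has_sup X.
  split; first by exists (\sum_(i \in set0) m i); exists set0 => //; exact: fsets_set0.
  by exists B => _ [F [finF FD] <-]; exact: mB.
have [_ [F [finF FD] <-] ltF] := sup_adherent e0 supX.
have finAD : finite_set (A `&` D) by exact: finite_setIl.
exists (F `|` (A `&` D)); split.
- by rewrite finite_setU; split.
- by move=> i [/FD|[]].
- by move=> i; right.
move=> G finG GD GF.
have disj : F `&` G `<=` set0.
  by move=> i [Fi Gi]; rewrite -GF; split => //; left.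
have : \sum_(i \in F `|` G) m i <= sup X.
  apply: (ub_le_sup supX.2); exists (F `|` G) => //; split.
    by rewrite finite_setU; split.
  by move=> i [/FD|/GD].
rewrite fsbigU0 //= => le_sup.
by move: ltF; rewrite -/X; lra.
Qed.
End FiniteSums.

(** * Comparison of norms on real row vectors *)

Section Norm.
Context {R : realType}.

(** [f] is Lipschitz for the sup norm, hence continuous, and has a positive minimum on the compact
    unit sphere; homogeneity carries the inverse of this minimum to all vectors. *)
Lemma rV_norm_dominated n (f : 'rV[R]_n -> R) :
  (forall u v, f (u + v) <= f u + f v) ->
  (forall a u, f (a *: u) = `|a| * f u) ->
  (forall u, f u = 0 -> u = 0) ->
  exists2 c, 0 <= c & forall u, `|u| <= c * f u.
Proof.
move=> fD fZ f0.
have f00 : f 0 = 0 by rewrite -(scale0r 0) fZ normr0 mul0r.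
have fN u : f (- u) = f u by rewrite -scaleN1r fZ normrN1 mul1r.
have f_ge0 u : 0 <= f u by have := fD u (- u); rewrite subrr f00 fN; lra.
pose L := \sum_(j < n) f (delta_mx 0 j).
have L0 : 0 <= L by apply: sumr_ge0.
have coordle (u : 'rV[R]_n) j : `|u 0 j| <= `|u|.
  rewrite [leRHS]/Num.norm /= mx_normrE.
  by apply/bigmax_geP; right => /=; exists (0, j).
have fL u : f u <= L * `|u|.
  rewrite [u in f u]row_sum_delta.
  have : f (\sum_(j < n) u 0 j *: delta_mx 0 j) <=
         \sum_(j < n) f (u 0 j *: delta_mx 0 j).
    elim/big_ind2 : _ => [|x1 x2 y1 y2 h1 h2|//]; first by rewrite f00.
    by apply: le_trans (fD _ _) _; apply: lerD.
  move=> /le_trans; apply; rewrite mulr_suml; apply: ler_sum => j _.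
  by rewrite fZ mulrC ler_wpM2l.
have f_cont : continuous f.
  move=> u; apply/(@cvgrPdist_le _ _ _ _ (nbhs_filter u)) => e e0; near=> v.
  have : `|f u - f v| <= L * `|u - v|.
    rewrite ler_norml; have := fL (u - v).
    have := fD (u - v) v; have := fD (v - u) u.
    by rewrite !subrK -(fN (v - u)) opprB; lra.
  move=> /le_trans; apply.
  apply: (@le_trans _ _ (L * (e / (L + 1)))).
    apply: ler_wpM2l => //.
    near: v; apply/(@nbhs_ballP R 'rV[R]_n); exists (e / (L + 1)) => [|v].
      by rewrite /= divr_gt0 // ltr_wpDl.
    by rewrite -(@ball_normE R 'rV[R]_n) => /ltW.
  by rewrite mulrCA ler_piMr ?(ltW e0) // ler_pdivrMr ?mul1r; lra.
have [sph0|nsph] := pselect ([set u : 'rV[R]_n | `|u| = 1] !=set0).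
  have [||u0 /set_mem/= u01 u0min] := @EVT_min_rV R n f _ sph0.
  - apply: bounded_closed_compact.
      by exists 1; split => // x x1 u /= ->; exact: ltW.
    apply: (@closed_comp _ _ (fun u : 'rV[R]_n => `|u|) [set 1]) => //.
    by move=> u _; exact: norm_continuous.
  - exact: continuous_subspaceT.
  have fu0 : 0 < f u0.
    rewrite lt_neqAle f_ge0 andbT eq_sym; apply: contraPneq u01 => /f0 ->.
    by rewrite normr0 => /esym/eqP; rewrite oner_eq0.
  exists (f u0)^-1 => [|u]; first by rewrite invr_ge0 ltW.
  have [->|u_neq0] := eqVneq u 0; first by rewrite normr0 f00 mulr0.
  have nu0 : 0 < `|u| by rewrite normr_gt0.
  have := u0min (`|u|^-1 *: u); rewrite inE /= mx_normZ normfV normr_id mulVf ?gt_eqF//.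
  move=> /(_ erefl); rewrite fZ normfV normr_id => h.
  by rewrite mulrC ler_pdivlMr // -ler_pdivlMl // mulrC.
(* An empty unit sphere forces the space to be zero, since a nonzero vector could be normalised. *)
exists 0 => // u; rewrite mul0r leNgt; apply/negP => nu0; apply: nsph.
by exists (`|u|^-1 *: u); rewrite /= mx_normZ normfV normr_id mulVf // gt_eqF.
Unshelve. all: by end_near. Qed.

End Norm.

(** * Summation in a finite-dimensional complex normed space *)

Section NormOnVector.
Context {R : realType} {U : vectType R[i]} (N : U -> R) (N_norm : is_norm N).

Lemma is_norm0 : N 0 = 0.
Proof. by case: N_norm => _ NZ _; rewrite -(scale0r 0) NZ Normc.normc0 mul0r. Qed.

Lemma is_norm_ge0 u : 0 <= N u.
Proof.
case: N_norm => ND NZ _; have := ND u (- u).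
rewrite subrr is_norm0 -scaleN1r NZ.
by rewrite (normcN (1 : Rcomplex R)) Normc.normc1 mul1r; lra.
Qed.

Lemma is_norm_sum (J : Type) (r : seq J) (F : J -> U) :
  N (\sum_(j <- r) F j) <= \sum_(j <- r) N (F j).
Proof.
case: N_norm => ND _ _; elim/big_ind2 : _ => [|x1 x2 y1 y2 h1 h2|//].
  by rewrite is_norm0.
by apply: le_trans (ND _ _) _; apply: lerD.
Qed.

Lemma normc_real (a : R) : Normc.normc a%:C%C = `|a|.
Proof. by rewrite /= expr0n addr0 sqrtr_sqr. Qed.

Lemma normc_le (a b : R) : Normc.normc (a +i* b)%C <= `|a| + `|b|.
Proof.
rewrite /= -[leRHS]ger0_norm ?addr_ge0 // -sqrtr_sqr; apply: ler_wsqrtr.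
rewrite -(real_normK (num_real a)) -(real_normK (num_real b)).
by have := mulr_ge0 (normr_ge0 a) (normr_ge0 b); rewrite sqrrD; lra.
Qed.

(** Through [psi] the real and imaginary parts of all coordinates form one real row vector, on which
    [N] becomes a real norm; [rV_norm_dominated] then applies. *)
Lemma coord_dominated : exists2 c, 0 <= c &
  forall v (j : 'I_(\dim {:U})),
    `|complex.Re (coord (vbasis {:U}) j v)| <= c * N v /\
    `|complex.Im (coord (vbasis {:U}) j v)| <= c * N v.
Proof.
case: (N_norm) => ND NZ N0.
set e := vbasis {:U}; set n := \dim {:U}.
pose psi (w : 'rV[R]_(n + n)) : U :=
  \sum_(j < n) (w 0 (lshift n j) +i* w 0 (rshift n j))%C *: e`_j.
have psiD u v : psi (u + v) = psi u + psi v.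
  rewrite /psi -big_split /=; apply: eq_bigr => j _.
  by rewrite -scalerDl !mxE.
have psiZ (a : R) u : psi (a *: u) = a%:C%C *: psi u.
  rewrite /psi scaler_sumr; apply: eq_bigr => j _.
  rewrite scalerA !mxE; congr (_ *: _).
  by apply/eqP; rewrite eq_complex /= !mul0r subr0 addr0 !eqxx.
have coord_psi w j :
    coord e j (psi w) = (w 0 (lshift n j) +i* w 0 (rshift n j))%C.
  by rewrite coord_sum_free // (basis_free (vbasisP _)).
have [||w psiw0|c c0 cP] := @rV_norm_dominated R (n + n) (N \o psi).
- by move=> u v /=; rewrite psiD.
- by move=> a u /=; rewrite psiZ NZ normc_real.
- move/N0 in psiw0.
  have h j : (w 0 (lshift n j) +i* w 0 (rshift n j))%C = 0.
    by rewrite -coord_psi psiw0 linear0.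
  apply/rowP => i; rewrite mxE; case: (split_ordP i) => j ->.
    by have [] := h j.
  by have [] := h j.
exists c => // v j.
pose w : 'rV[R]_(n + n) := row_mx (\row_k complex.Re (coord e k v))
                                  (\row_k complex.Im (coord e k v)).
have psiw : psi w = v.
  rewrite [RHS](coord_vbasis (memvf v)); apply: eq_bigr => k _.
  rewrite /w row_mxEl row_mxEr !mxE; congr (_ *: _).
  by case: (coord _ _ _).
have := cP w; rewrite /= psiw => cw.
have entry k : `|w 0 k| <= c * N v.
  apply: le_trans cw; rewrite [leRHS]/Num.norm /= mx_normrE.
  by apply/bigmax_geP; right => /=; exists (0, k).
have := entry (lshift n j); have := entry (rshift n j).
by rewrite /w row_mxEl row_mxEr !mxE.
Qed.

(* [a = (|a| + a) - |a|] splits a real family into nonnegative ones. *)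
Definition real_net_sum {I : choiceType} (D : set I) (a : I -> R) : R :=
  net_sum D (fun i => `|a i| + a i) - net_sum D (fun i => `|a i|).

(** As [|a| + a <= 2 |a|], the two nonnegative pieces have errors in [[0, 2e]] and [[0, e]], so
    their difference errs by at most [2e]. *)
Lemma real_net_sum_tail (I : choiceType) (D : set I) (a : I -> R) (e : R) F0 :
  finite_set F0 -> F0 `<=` D ->
  (forall G, finite_set G -> G `<=` D -> G `&` F0 = set0 ->
     \sum_(i \in G) `|a i| <= e) ->
  forall F, finite_set F -> F0 `<=` F -> F `<=` D ->
    `|real_net_sum D a - \sum_(i \in F) a i| <= 2 * e.
Proof.
move=> finF0 F0D tail F finF F0F FD.
have a0 i : 0 <= `|a i| + a i by rewrite -lerBlDl sub0r lerNnormlW.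
have /andP[h1 h2] : 0 <= net_sum D (fun i => `|a i| + a i) -
    \sum_(i \in F) (`|a i| + a i) <= 2 * e.
  apply: (net_sum_tail a0 finF0) => // G finG GD GF0.
  apply: (@le_trans _ _ (\sum_(i \in G) 2 * `|a i|)).
    apply: ler_fsumr => // i _.
    by rewrite mulr2n mulrDl !mul1r lerD2l ler_norm.
  by rewrite -mulr_fsumr ler_pM2l // tail.
have /andP[h3 h4] : 0 <= net_sum D (fun i => `|a i|) -
    \sum_(i \in F) `|a i| <= e.
  by apply: (net_sum_tail _ finF0).
have : \sum_(i \in F) (`|a i| + a i) =
    \sum_(i \in F) `|a i| + \sum_(i \in F) a i.
  by rewrite fsbig_split.
by rewrite /real_net_sum ler_norml => h5; lra.
Qed.

(** The candidate limit is fixed once, coordinate by coordinate, independently of [K]; only the tail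
    estimate uses the majorant of the given [K]. The exceptional indices are harmless because the
    net may start beyond them. *)
Lemma weierstrass_Mtest (I : choiceType) (T : topologicalType) (D : set I)
    (f : I -> T -> U) (X : set T) :
  (forall K, compact K -> K `<=` X ->
     exists (A : set I) (m : I -> R) (B : R),
     [/\ finite_set A, forall i, 0 <= m i,
        forall F, finite_set F -> F `<=` D -> \sum_(i \in F) m i <= B &
        forall i x, D i -> ~ A i -> K x -> N (f i x) <= m i]) ->
  cvg_absolutely_compactly N D f X.
Proof.
move=> dom; split=> [x Xx|].
  have [|y -> //|A [m [B [finA m0 mB fm]]]] := dom [set x].
    exact: compact_set1.
  have finAD : finite_set (A `&` D) by exact: finite_setIl.
  rewrite /summable (@le_lt_trans _ _
    (\sum_(i \in A `&` D) N (f i x) + B)%:E) ?ltry //.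
  apply: ge_ereal_sup => _ [F [finF FD] <-].
  rewrite (eq_fsbigr (fun i => (N (f i x))%:E)) => [|i _]; last first.
    by rewrite gee0_abs // lee_fin is_norm_ge0.
  rewrite fsbig_finite // sumEFin lee_fin -fsbig_finite //.
  rewrite (fsbigID A F) //=; apply: lerD.
    apply: ler_fsumr_subset => // [i [/FD]//|i]; exact: is_norm_ge0.
  apply: (@le_trans _ _ (\sum_(i \in F `&` ~` A) m i)).
    apply: ler_fsumr => [|i [/FD Di Ai]]; first exact: finite_setIl.
    exact: fm.
  by apply: mB => [|i [/FD]//]; exact: finite_setIl.
set e := vbasis {:U}; set n := \dim {:U}.
pose a (j : 'I_n) x i := complex.Re (coord e j (f i x)).
pose b (j : 'I_n) x i := complex.Im (coord e j (f i x)).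
exists (fun x => \sum_(j < n)
  (real_net_sum D (a j x) +i* real_net_sum D (b j x))%C *: e`_j).
move=> K cK KX eps eps0.
have [A [m [B [finA m0 mB fm]]]] := dom K cK KX.
have [c c0 cP] := coord_dominated.
pose L := \sum_(j < n) N e`_j.
have L0 : 0 <= L by apply: sumr_ge0 => j _; exact: is_norm_ge0.
(* Real and imaginary parts each err by [2 * c * eps1] per coordinate, giving [4 * c * eps1 * L] in
   all; the added ones keep the denominator positive and the final inequality strict. *)
pose eps1 := eps / (4 * (c + 1) * (L + 1)).
have den0 : 0 < 4 * (c + 1) * (L + 1) by rewrite !mulr_gt0 //; lra.
have eps1_gt0 : 0 < eps1 by rewrite divr_gt0.
have [F0 [finF0 F0D AF0 tail]] := bounded_fsumr_tail m0 mB eps1_gt0 finA.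
exists F0 => // F finF F0F FD x Kx.
have tail_c (h : I -> R) : (forall i, `|h i| <= c * N (f i x)) ->
    forall G, finite_set G -> G `<=` D -> G `&` F0 = set0 ->
    \sum_(i \in G) `|h i| <= c * eps1.
  move=> hc G finG GD GF0.
  apply: (@le_trans _ _ (\sum_(i \in G) c * m i)).
    apply: ler_fsumr => // i Gi; apply: le_trans (hc i) _.
    apply: ler_wpM2l => //; apply: fm => // [|Ai]; first exact: GD.
    have : (G `&` F0) i by split => //; apply: AF0; split => //; exact: GD.
    by rewrite GF0.
  by rewrite -mulr_fsumr ler_wpM2l // tail.
have sum_coord : \sum_(i \in F) f i x = \sum_(j < n)
    ((\sum_(i \in F) a j x i) +i* (\sum_(i \in F) b j x i))%C *: e`_j.
  rewrite [LHS](coord_vbasis (memvf _)); apply: eq_bigr => j _.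
  congr (_ *: _); rewrite !fsbig_finite // linear_sum /=.
  elim: (finmap.enum_fset _) => [|i s IHs]; first by rewrite !big_nil.
  by rewrite !big_cons IHs /a /b -/e; case: (coord e j (f i x)) => ? ?.
rewrite sum_coord -sumrB; apply: le_lt_trans (is_norm_sum _ _) _.
apply: (@le_lt_trans _ _ (\sum_(j < n) (4 * (c * eps1)) * N e`_j)).
  apply: ler_sum => j _; rewrite -scalerBl.
  case: (N_norm) => _ NZ _; rewrite NZ; apply: ler_wpM2r.
    exact: is_norm_ge0.
  apply: le_trans (normc_le _ _) _.
  have ha : forall i, `|a j x i| <= c * N (f i x) by move=> i; exact: (cP _ _).1.
  have hb : forall i, `|b j x i| <= c * N (f i x) by move=> i; exact: (cP _ _).2.
  have := real_net_sum_tail finF0 F0D (tail_c _ ha) finF F0F FD.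
  have := real_net_sum_tail finF0 F0D (tail_c _ hb) finF F0F FD.
  lra.
rewrite -mulr_sumr -/L.
have -> : 4 * (c * eps1) * L = eps * (4 * c * L / (4 * (c + 1) * (L + 1))).
  by rewrite /eps1; field; lra.
by rewrite gtr_pMr // ltr_pdivrMr // mul1r; lra.
Qed.
End NormOnVector.

(** * Packing of matrices and counting of cusp cosets *)

Section SL2Entries.
Context {R : realType}.
Implicit Types (A B : SL2 R) (g : PSL2 R).

Lemma det_mx2 (M : 'M[R]_2) : \det M = M 0 0 * M 1 1 - M 0 1 * M 1 0.
Proof.
rewrite (expand_det_col _ 0) !big_ord_recl big_ord0 addr0 /cofactor.
rewrite [row' _ _]mx11_scalar [X in _ + _ * (_ * \det X)]mx11_scalar.
rewrite !det_scalar1 !mxE /= expr0 mul1r expr1 mulN1r mulrN [X in _ - X]mulrC.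
by congr (M _ _ * M _ _ - M _ _ * M _ _); apply: val_inj.
Qed.

Lemma mulmx2E (M1 M2 : 'M[R]_2) i j :
  (M1 *m M2) i j = M1 i 0 * M2 0 j + M1 i 1 * M2 1 j.
Proof.
rewrite mxE !big_ord_recl big_ord0 addr0.
by congr (_ + M1 _ _ * M2 _ _); apply: val_inj.
Qed.

Lemma SL2_det A : val A 0 0 * val A 1 1 - val A 0 1 * val A 1 0 = 1.
Proof. by rewrite -det_mx2; exact/eqP/(valP A). Qed.

Lemma SL2_mulE A B i j :
  val (A * B)%g i j = val A i 0 * val B 0 j + val A i 1 * val B 1 j.
Proof. exact: mulmx2E. Qed.

Lemma mx2P (M1 M2 : 'M[R]_2) : M1 0 0 = M2 0 0 -> M1 0 1 = M2 0 1 ->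
  M1 1 0 = M2 1 0 -> M1 1 1 = M2 1 1 -> M1 = M2.
Proof.
move=> h00 h01 h10 h11; apply/matrixP => i j.
case: (unliftP 0 i) => [i'|] ->; case: (unliftP 0 j) => [j'|] -> //;
  rewrite ?[i']ord1 ?[j']ord1.
- by rewrite (_ : lift 0 0 = 1) //; apply: val_inj.
- by rewrite (_ : lift 0 0 = 1) //; apply: val_inj.
- by rewrite (_ : lift 0 0 = 1) //; apply: val_inj.
Qed.

Lemma SL2_invE A : val (A^-1)%g = mx22 (val A 1 1) (- val A 0 1)
  (- val A 1 0) (val A 0 0).
Proof.
rewrite -[RHS]mulmx1 -(mulmxV (SL2_unitmx A)) mulmxA.
rewrite [X in X *m _](_ : _ = 1%:M) ?mul1mx //.
by apply: mx2P; rewrite mulmx2E !mxE /=; have := SL2_det A; lra.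
Qed.

Lemma PSL2_pi_mul A B :
  \pi_(PSL2 R)%qT (A * B)%g = (\pi_(PSL2 R)%qT A * \pi_(PSL2 R)%qT B)%g.
Proof. by rewrite -PSL2_piM. Qed.

Lemma PSL2_pi_inv A : \pi_(PSL2 R)%qT A^-1%g = (\pi_(PSL2 R)%qT A)^-1%g.
Proof. by rewrite -PSL2_piV. Qed.

Lemma unipD (s t : R) : (unip s * unip t)%g = unip (s + t).
Proof.
rewrite /unip -PSL2_pi_mul; congr (\pi_(PSL2 R)%qT _); apply: val_inj => /=.
by apply: mx2P; rewrite mulmx2E !mxE /=; ring.
Qed.

Lemma unip0 : unip (0 : R) = 1%g.
Proof.
by congr (\pi_(PSL2 R)%qT _); apply: val_inj; apply: mx2P; rewrite !mxE.
Qed.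

Lemma unipN (t : R) : unip (- t) = (unip t)^-1%g.
Proof. by apply: (mulgI (unip t)); rewrite unipD subrr unip0 mulgV. Qed.

Lemma unip1_neq1 : unip (1 : R) <> 1%g.
Proof.
move=> /PSL2_piP [|] /(congr1 (fun A => val A 0 1)).
  by rewrite !mxE /= => /eqP; rewrite oner_eq0.
by rewrite !mxE /= oppr0 => /eqP; rewrite oner_eq0.
Qed.

(** Isolation of the identity provides a neighbourhood in the quotient topology; its preimage in
    SL_2 is a neighbourhood of the identity matrix in the subspace topology, so it contains an
    entrywise ball. *)
Lemma fuchsian_discrete (Gamma : set (PSL2 R)) : fuchsian Gamma ->
  exists2 d : R, 0 < d & forall B : SL2 R, Gamma (\pi_(PSL2 R)%qT B) ->
    (forall i j, `|val B i j - (i == j)%:R| < d) -> \pi_(PSL2 R)%qT B = 1%g.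
Proof.
move=> [[G1 _] disc].
have /disc [_ [V V1 VG]] : Gamma 1%g by rewrite inE in G1.
have : nbhs (1%g : SL2 R) (\pi_(PSL2 R)%qT @^-1` V).
  exact: (@pi_continuous (SL2 R) (PSL2 R)).
rewrite nbhsE => -[_ [[W oW <-] W1] WV].
have : nbhs (1%:M : 'M[R]_2) W by apply: open_nbhs_nbhs; split.
move=> /(@nbhs_ballP R 'M[R]_2)[d d0 dW]; exists d => // B GB Bd.
have : (V `&` Gamma) (\pi_(PSL2 R)%qT B).
  split => //; apply: WV; apply: dW; split=> // i j.
  by rewrite /ball /= mxE distrC.
by rewrite VG.
Qed.

End SL2Entries.

(** * Iwasawa coordinates and nearby matrices *)

Section Boxes.
Context {R : realType}.
Implicit Types A B : SL2 R.

Let ler_normM (x y a b : R) : `|x| <= a -> `|y| <= b -> `|x * y| <= a * b.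
Proof. by move=> xa yb; rewrite normrM ler_pM. Qed.

Let ler_norm2 (x y : R) : x ^+ 2 + y ^+ 2 <= 4 -> `|x| <= 2.
Proof.
move=> h; rewrite -(@ler_pXn2r _ 2) ?nnegrE // real_normK ?num_real //.
by have := sqr_ge0 y; lra.
Qed.

(* The four expressions are the entries of A^-1 B - 1 in Iwasawa coordinates,
   see [same_box_close]: (c, d) is the bottom row, m = 1 / (c^2 + d^2), and X is
   the difference of the real parts of B.i and A.i. *)
Lemma scaled_box (eta X c1 d1 c2 d2 m1 m2 : R) :
  1 <= c1 ^+ 2 + d1 ^+ 2 <= 4 -> 1 <= c2 ^+ 2 + d2 ^+ 2 <= 4 ->
  m1 * (c1 ^+ 2 + d1 ^+ 2) = 1 -> m2 * (c2 ^+ 2 + d2 ^+ 2) = 1 ->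
  `|X| <= eta -> `|c2 - c1| <= eta -> `|d2 - d1| <= eta ->
  [/\ `|X * (d1 * c2) + d1 * d2 * m2 + c1 * c2 * m1 - 1| <= 40 * eta,
      `|X * (d1 * d2) - d1 * c2 * m2 + c1 * d2 * m1| <= 40 * eta,
      `|- X * (c1 * c2) + d1 * c2 * m1 - c1 * d2 * m2| <= 40 * eta &
      `|- X * (c1 * d2) + d1 * d2 * m1 + c1 * c2 * m2 - 1| <= 40 * eta].
Proof.
move=> /andP[r1_ge r1_le] /andP[r2_ge r2_le] m1E m2E hX hc hd.
have c1_le := ler_norm2 r1_le; have c2_le := ler_norm2 r2_le.
have d1_le : `|d1| <= 2 by apply: (@ler_norm2 _ c1); rewrite addrC.
have d2_le : `|d2| <= 2 by apply: (@ler_norm2 _ c2); rewrite addrC.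
have inv_le1 (m r : R) : 1 <= r -> m * r = 1 -> `|m| <= 1.
  move=> r1 mr; have m0 : 0 < m.
    by rewrite -(pmulr_lgt0 _ (lt_le_trans ltr01 r1)) mr.
  by rewrite gtr0_norm // -mr ler_peMr // ltW.
have m1_le := inv_le1 _ _ r1_ge m1E; have m2_le := inv_le1 _ _ r2_ge m2E.
have mm : m2 - m1 = m1 * m2 * ((c1 - c2) * (c1 + c2) + (d1 - d2) * (d1 + d2)).
  transitivity (m1 * m2 * (c1 ^+ 2 + d1 ^+ 2) - m1 * m2 * (c2 ^+ 2 + d2 ^+ 2)).
    by rewrite {1}mulrAC m1E -mulrA m2E mul1r mulr1.
  by ring.
have hs (x y : R) : `|x| <= 2 -> `|y| <= 2 -> `|x + y| <= 4.
  by move=> hx hy; apply: le_trans (ler_normD _ _) _; lra.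
have mm_le : `|m2 - m1| <= 8 * eta.
  rewrite mm; apply: le_trans (ler_normM (ler_normM m1_le m2_le) _) _.
    apply: le_trans (ler_normD _ _) _; apply: lerD.
      by apply: ler_normM; [rewrite distrC; exact: hc | exact: hs].
    by apply: ler_normM; [rewrite distrC; exact: hd | exact: hs].
  by lra.
(* The four products are at most [4 eta], [4 * 8 eta], [2 eta] and [2 eta], whence the constant
   [40]. *)
have bound (u v w p q : R) : `|u| <= 2 -> `|v| <= 2 -> `|w| <= 1 ->
    `|p| <= 2 -> `|q| <= 2 -> forall y z k l t : R,
    `|k| <= 2 -> `|l| <= 2 -> `|t| <= 1 -> `|y| <= eta -> `|z| <= eta ->
    `|X * (u * v) + p * q * (m2 - m1) + k * y * w + l * z * t| <= 40 * eta.
  move=> hu hv hw hp hq y z k l t hk hl ht hy hz.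
  have h1 := ler_normM hX (ler_normM hu hv).
  have h2 := ler_normM (ler_normM hp hq) mm_le.
  have h3 := ler_normM (ler_normM hk hy) hw.
  have h4 := ler_normM (ler_normM hl hz) ht.
  apply: le_trans (ler_normD _ _) _.
  have := ler_normD (X * (u * v) + p * q * (m2 - m1)) (k * y * w).
  by have := ler_normD (X * (u * v)) (p * q * (m2 - m1)); lra.
have N_le (x e : R) : `|x| <= e -> `|- x| <= e by rewrite normrN.
(* Rewriting the [1] of the diagonal entries in this way exhibits them as combinations of coordinate
   differences. *)
have {}m1E : 1 = m1 * (c1 ^+ 2 + d1 ^+ 2) by [].
split.
- rewrite [X in `|_ - X|]m1E.
  rewrite (_ : _ - _ = X * (d1 * c2) + d1 * d2 * (m2 - m1) +
    d1 * (d2 - d1) * m1 + c1 * (c2 - c1) * m1); last by ring.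
  exact: bound.
- rewrite (_ : _ + _ = X * (d1 * d2) + (- d1) * c2 * (m2 - m1) +
    c1 * (d2 - d1) * m1 + (- d1) * (c2 - c1) * m1); last by ring.
  by apply: bound => //; exact: N_le.
- rewrite (_ : _ - _ = X * ((- c1) * c2) + (- c1) * d2 * (m2 - m1) +
    d1 * (c2 - c1) * m1 + (- c1) * (d2 - d1) * m1); last by ring.
  by apply: bound => //; exact: N_le.
- rewrite [X in `|_ - X|]m1E.
  rewrite (_ : _ - _ = X * ((- c1) * d2) + c1 * c2 * (m2 - m1) +
    d1 * (d2 - d1) * m1 + c1 * (c2 - c1) * m1); last by ring.
  by apply: bound => //; exact: N_le.
Qed.

Definition bottom2 (A : SL2 R) : R := val A 1 0 ^+ 2 + val A 1 1 ^+ 2.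

(* The real part of the image of 'i. *)
Definition reI (A : SL2 R) : R :=
  (val A 0 0 * val A 1 0 + val A 0 1 * val A 1 1) / bottom2 A.

Lemma bottom2_gt0 A : 0 < bottom2 A.
Proof.
rewrite lt_neqAle addr_ge0 ?sqr_ge0 // andbT eq_sym paddr_eq0 ?sqr_ge0 //.
rewrite !sqrf_eq0; apply/negP => /andP[/eqP c0 /eqP d0].
by have /eqP := SL2_det A; rewrite c0 d0 !mulr0 subrr eq_sym oner_eq0.
Qed.

(** Iwasawa decomposition. With rows [(a, b)] and [(c, d)], it rests on [a (c^2 + d^2) = c (ac + bd)
    + d (ad - bc)] and its analogue for [b]. *)
Lemma top_rowE A :
  val A 0 0 = reI A * val A 1 0 + val A 1 1 / bottom2 A /\
  val A 0 1 = reI A * val A 1 1 - val A 1 0 / bottom2 A.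
Proof.
have r0 := bottom2_gt0 A; have detA := SL2_det A.
have rE : bottom2 A != 0 by rewrite gt_eqF.
rewrite /reI; split; apply: (mulIf rE).
  rewrite mulrDl mulfVK // mulrAC mulfVK //.
  by have := congr1 ( *%R (val A 1 1)) detA; rewrite /bottom2; lra.
rewrite mulrBl mulfVK // mulrAC mulfVK //.
by have := congr1 ( *%R (val A 1 0)) detA; rewrite /bottom2; lra.
Qed.

(** Multiplying [A] and [B] on the left by diag(q, 1/q) leaves [A^-1 B] unchanged, divides the
    bottom rows by [q] and multiplies the real parts by [q^2]. This normalises the bottom rows to
    the range of [scaled_box]. *)
Lemma same_box_close (eta q : R) (A B : SL2 R) : 0 < q ->
  q ^+ 2 <= bottom2 A <= 4 * q ^+ 2 -> q ^+ 2 <= bottom2 B <= 4 * q ^+ 2 ->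
  `|q ^+ 2 * (reI B - reI A)| <= eta ->
  `|val B 1 0 / q - val A 1 0 / q| <= eta ->
  `|val B 1 1 / q - val A 1 1 / q| <= eta ->
  forall i j, `|val (A^-1 * B)%g i j - (i == j)%:R| <= 40 * eta.
Proof.
move=> q0 rA rB hX hc hd.
have q_neq0 : q != 0 by rewrite gt_eqF.
have q2_gt0 : 0 < q ^+ 2 by rewrite exprn_gt0.
have rA0 : bottom2 A != 0 by rewrite gt_eqF ?bottom2_gt0.
have rB0 : bottom2 B != 0 by rewrite gt_eqF ?bottom2_gt0.
have scaled (D : SL2 R) :
    (val D 1 0 / q) ^+ 2 + (val D 1 1 / q) ^+ 2 = bottom2 D / q ^+ 2.
  by rewrite /bottom2 mulrDl !expr_div_n.
have in14 (D : SL2 R) : q ^+ 2 <= bottom2 D <= 4 * q ^+ 2 ->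
    1 <= (val D 1 0 / q) ^+ 2 + (val D 1 1 / q) ^+ 2 <= 4.
  by rewrite scaled ler_pdivlMr // ler_pdivrMr // mul1r.
have minv (D : SL2 R) : bottom2 D != 0 ->
    q ^+ 2 / bottom2 D * ((val D 1 0 / q) ^+ 2 + (val D 1 1 / q) ^+ 2) = 1.
  by move=> D0; rewrite scaled; field; rewrite D0 q_neq0.
have [h00 h01 h10 h11] :=
  scaled_box (in14 _ rA) (in14 _ rB) (minv _ rA0) (minv _ rB0) hX hc hd.
have [a1 b1] := top_rowE A; have [a2 b2] := top_rowE B.
have one : lift (0 : 'I_2) ord0 = 1 by exact: val_inj.
move=> i j; case: (unliftP 0 i) => [i'|] ->; case: (unliftP 0 j) => [j'|] ->;
  rewrite ?[i']ord1 ?[j']ord1 ?one SL2_mulE SL2_invE !mxE /= ?subr0.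
- rewrite a1 b2 [X in `|X|](_ : _ = - (q ^+ 2 * (reI B - reI A)) *
    (val A 1 0 / q * (val B 1 1 / q)) + val A 1 1 / q * (val B 1 1 / q) *
    (q ^+ 2 / bottom2 A) + val A 1 0 / q * (val B 1 0 / q) *
    (q ^+ 2 / bottom2 B) - 1) //; field; exact/and3P.
- rewrite a1 a2 [X in `|X|](_ : _ = - (q ^+ 2 * (reI B - reI A)) *
    (val A 1 0 / q * (val B 1 0 / q)) + val A 1 1 / q * (val B 1 0 / q) *
    (q ^+ 2 / bottom2 A) - val A 1 0 / q * (val B 1 1 / q) *
    (q ^+ 2 / bottom2 B)) //; field; exact/and3P.
- rewrite b1 b2 [X in `|X|](_ : _ = q ^+ 2 * (reI B - reI A) *
    (val A 1 1 / q * (val B 1 1 / q)) - val A 1 1 / q * (val B 1 0 / q) *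
    (q ^+ 2 / bottom2 B) + val A 1 0 / q * (val B 1 1 / q) *
    (q ^+ 2 / bottom2 A)) //; field; exact/and3P.
- rewrite b1 a2 [X in `|X|](_ : _ = q ^+ 2 * (reI B - reI A) *
    (val A 1 1 / q * (val B 1 0 / q)) + val A 1 1 / q * (val B 1 1 / q) *
    (q ^+ 2 / bottom2 B) + val A 1 0 / q * (val B 1 0 / q) *
    (q ^+ 2 / bottom2 A) - 1) //; field; exact/and3P.
Qed.
End Boxes.

(** * Counting by levels of ratio 4 *)

Section Levels.
Context {R : realType}.

(** Labels injective on level [k] bound its size by [M * 4 ^ k], so the sum is dominated by a
    geometric series of ratio [4 * t]. *)
Lemma level_sum_le (I : choiceType) (D : set I) (lev : I -> nat) (M : nat) :
  (forall k, exists (L : finType) (lab : I -> L), (#|L| <= M * 4 ^ k)%N /\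
     forall i j, D i -> D j -> lev i = k -> lev j = k -> lab i = lab j ->
       i = j) ->
  forall t : R, 0 <= t -> 4 * t < 1 ->
  forall F, finite_set F -> F `<=` D ->
    \sum_(i \in F) t ^+ lev i <= M%:R / (1 - 4 * t).
Proof.
move=> labels t t0 t1 F finF FD.
rewrite fsbig_finite //; set s := finmap.enum_fset _.
have s_uniq : uniq s by exact: finmap.fset_uniq.
have sD i : i \in s -> D i by rewrite in_fset_set // inE => /FD.
pose K := (\max_(i <- s) lev i).+1.
have cnt k : (count (fun i => lev i == k) s <= M * 4 ^ k)%N.
  have [L [lab [cardL lab_inj]]] := labels k.
  apply: leq_trans cardL; rewrite -size_filter -(size_map lab).
  rewrite -(card_uniqP _) ?max_card // map_inj_in_uniq ?filter_uniq //.
  move=> i j; rewrite !mem_filter => /andP[/eqP ik /sD Di] /andP[/eqP jk /sD Dj].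
  exact: lab_inj.
have -> : \sum_(i <- s) t ^+ lev i =
    \sum_(k < K) \sum_(i <- s | lev i == k) t ^+ k.
  rewrite (exchange_big_dep predT) //=; apply: eq_big_seq => i si.
  have ltK : (lev i < K)%N by rewrite ltnS; apply: leq_bigmax_seq.
  by rewrite (big_pred1 (Ordinal ltK)).
apply: (@le_trans _ _ (\sum_(k < K) M%:R * (4 * t) ^+ k)).
  apply: ler_sum => k _; rewrite big_const_seq iter_addr_0 exprMn mulrA -[X in X <= _]mulr_natl.
  rewrite ler_wpM2r ?exprn_ge0 // -natrX -natrM ler_nat; exact: cnt.
rewrite -mulr_sumr ler_wpM2l // -[leRHS]mul1r ler_pdivlMr ?subr_gt0 //.
have h := subrX1 (4 * t) K.
have : 0 <= (4 * t) ^+ K by rewrite exprn_ge0 // mulr_ge0.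
by move: h; lra.
Qed.

Lemma exists_level (delta r : R) : 0 < delta -> delta <= r ->
  exists k : nat, delta * 4 ^+ k <= r <= delta * 4 ^+ k.+1.
Proof.
move=> d0 dr.
have : exists k : nat, r < delta * 4 ^+ k.+1.
  exists (Num.truncn (r / delta)); rewrite mulrC -ltr_pdivrMr //.
  have /andP[_ /lt_le_trans] := truncn_itv (divr_ge0 (le_trans (ltW d0) dr) (ltW d0)).
  by apply; rewrite -natrX ler_nat ltnW // ltn_expl.
move=> /ex_minnP[k rk mink]; exists k; rewrite (ltW rk) andbT.
(* The least such [k] works: for [k = 0] the lower bound is the hypothesis [delta <= r], otherwise
   it is minimality. *)
case: k rk mink => [|k] _ mink; first by rewrite expr0 mulr1.
by rewrite leNgt; apply/negP => /mink; rewrite ltnn.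
Qed.

Lemma truncn_eq_dist (x y : R) : 0 <= x -> 0 <= y ->
  Num.truncn x = Num.truncn y -> `|x - y| <= 1.
Proof.
move=> /truncn_itv/andP[x1 x2] /truncn_itv/andP[y1 y2] xy.
rewrite xy in x1 x2; move: x2 y2; rewrite -natr1 ler_norml => x2 y2; lra.
Qed.

(** The bound by [n] keeps the integer parts inside ['I_n.+1], so [inord] never returns its default
    value. *)
Lemma inord_truncn_dist (n : nat) (x y : R) : 0 <= x <= n%:R -> 0 <= y <= n%:R ->
  inord (Num.truncn x) = inord (Num.truncn y) :> 'I_n.+1 -> `|x - y| <= 1.
Proof.
move=> /andP[x0 xn] /andP[y0 yn] /(congr1 val) /=.
have bnd (z : R) : 0 <= z -> z <= n%:R -> (Num.truncn z < n.+1)%N.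
  move=> z0 zn; rewrite truncn_lt_nat //.
  by apply: le_lt_trans zn _; rewrite ltr_nat.
by rewrite !inordK ?bnd //; exact: truncn_eq_dist.
Qed.

End Levels.

(** * Cosets of a cusp stabiliser in a Fuchsian group *)

Section CuspCosets.
Context {R : realType} (Gamma : set (PSL2 R)) (c : Rhat R) (sigma : PSL2 R).
Hypotheses (Gamma_fuchsian : fuchsian Gamma)
  (sigma_scaling : cusp_scaling Gamma c sigma).

Let GammaM g h : Gamma g -> Gamma h -> Gamma (g * h)%g.
Proof.
case: Gamma_fuchsian => [[G1 Gdiv] _] Gg Gh.
rewrite inE in G1.
have Gh' : Gamma h^-1%g.
  by have := Gdiv 1%g h; rewrite !inE div1g; apply.
by have := Gdiv g h^-1%g; rewrite !inE invgK; apply.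
Qed.

Let GammaV g : Gamma g -> Gamma g^-1%g.
Proof.
case: Gamma_fuchsian => [[G1 Gdiv] _] Gg; rewrite inE in G1.
by have := Gdiv 1%g g; rewrite !inE div1g; apply.
Qed.

Lemma stab_unip (n : int) : stab Gamma c (sigma * unip n%:~R * sigma^-1)%g.
Proof.
have : [set unip (n%:~R : R) | n in [set: int]] (unip n%:~R) by exists n.
rewrite -sigma_scaling.2 => -[g gs <-].
by rewrite !mulgA mulgV mul1g mulgK.
Qed.

Lemma stabE p : stab Gamma c p ->
  exists n : int, p = (sigma * unip n%:~R * sigma^-1)%g.
Proof.
move=> sp; have : [set (sigma^-1 * g * sigma)%g | g in stab Gamma c]
  (sigma^-1 * p * sigma)%g by exists p.
rewrite sigma_scaling.2 => -[n _ nE]; exists n.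
by rewrite nE !mulgA mulgV mul1g mulgK.
Qed.

Lemma stabM p q : stab Gamma c p -> stab Gamma c q -> stab Gamma c (p * q)%g.
Proof.
move=> /stabE[n ->] /stabE[m ->].
rewrite [X in stab _ _ X](_ : _ = sigma * unip (n + m)%:~R * sigma^-1)%g.
  exact: stab_unip.
by rewrite intrD -unipD !mulgA mulgVK.
Qed.

Lemma stabV p : stab Gamma c p -> stab Gamma c p^-1%g.
Proof.
move=> /stabE[n ->].
rewrite [X in stab _ _ X](_ : _ = sigma * unip (- n)%:~R * sigma^-1)%g.
  exact: stab_unip.
by rewrite intrN unipN !invgM invgK !mulgA.
Qed.

Lemma right_coset_mul p g : stab Gamma c p ->
  right_coset (stab Gamma c) (p * g)%g = right_coset (stab Gamma c) g.
Proof.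
move=> sp; apply/seteqP; split=> _ [h sh <-].
  by exists (h * p)%g; [exact: stabM | rewrite mulgA].
exists (h * p^-1)%g; first by apply: stabM => //; exact: stabV.
by rewrite mulgA mulgVK.
Qed.

(** Each coset is nonempty because the stabiliser contains the identity, so [xget] picks a genuine
    element rather than its default. *)
Lemma coset_reprP A : coset_space (stab Gamma c) Gamma A ->
  Gamma (coset_repr A) /\ right_coset (stab Gamma c) (coset_repr A) = A.
Proof.
move=> [g Gg <-]; rewrite /coset_repr.
have [|p sp <-] := xgetPex 1%g (P := right_coset (stab Gamma c) g).
  exists g, 1%g; last by rewrite mul1g.
  by rewrite -(mulgV (sigma * unip 0%:~R * sigma^-1)%g); apply: stabM;
    [|apply: stabV]; exact: stab_unip.
by split; [apply: GammaM => //; exact: sp.1 | exact: right_coset_mul].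
Qed.

(** The inverse of the imaginary part of [sigma^-1 g.i]; the squares make the sign of the
    representative matrix irrelevant. *)
Let bottom_coset g := bottom2 (repr (sigma^-1 * g)%g).

(* If [repr (sigma^-1 g)] has bottom row (c, d), then g^-1 (sigma T sigma^-1) g,
   with T the unit translation, is ((1 + cd, d^2), (-c^2, 1 - cd)). *)
Lemma bottom_coset_ge (delta : R) g :
  (forall B : SL2 R, Gamma (\pi_(PSL2 R)%qT B) ->
    (forall i j, `|val B i j - (i == j)%:R| < delta) -> \pi_(PSL2 R)%qT B = 1%g) ->
  Gamma g -> delta <= bottom_coset g.
Proof.
move=> disc Gg; rewrite leNgt; apply/negP => lt_delta.
set A := repr (sigma^-1 * g)%g in lt_delta.
have piA : \pi_(PSL2 R)%qT A = (sigma^-1 * g)%g by rewrite reprK.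
pose B : SL2 R := (A^-1 * mkSL2 (unip_subproof 1) * A)%g.
have piB : \pi_(PSL2 R)%qT B = (g^-1 * (sigma * unip 1%:~R * sigma^-1) * g)%g.
  rewrite /B 2!PSL2_pi_mul PSL2_pi_inv piA -/(unip 1) invgM invgK !mulgA.
  by rewrite mulr1z.
(* The entries of [B - 1] are at most [c^2 + d^2 < delta] in absolute value, so [B] is trivial;
   conjugating back would make the unit translation trivial. *)
have : \pi_(PSL2 R)%qT B = 1%g.
  apply: disc => [|i j].
    by rewrite piB; apply: GammaM => //; apply: GammaM;
      [exact: GammaV | exact: (stab_unip 1).1].
  apply: le_lt_trans lt_delta; rewrite /bottom_coset -/A /bottom2.
  have entry (k l : 'I_2) : val B k l =
      (val (A^-1)%g k 0 * 1 + val (A^-1)%g k 1 * 0) * val A 0 l +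
      (val (A^-1)%g k 0 * 1 + val (A^-1)%g k 1 * 1) * val A 1 l.
    by rewrite !SL2_mulE !mxE.
  have detA := SL2_det A.
  have le_cd : `|val A 1 0 * val A 1 1| <= val A 1 0 ^+ 2 + val A 1 1 ^+ 2.
    rewrite ler_norml; have := sqr_ge0 (val A 1 0 + val A 1 1).
    have := sqr_ge0 (val A 1 0 - val A 1 1).
    have := sqr_ge0 (val A 1 0); have := sqr_ge0 (val A 1 1); lra.
  have one : lift (0 : 'I_2) ord0 = 1 by exact: val_inj.
  case: (unliftP 0 i) => [i'|] ->; case: (unliftP 0 j) => [j'|] ->;
    rewrite ?[i']ord1 ?[j']ord1 ?one entry SL2_invE !mxE /= ?subr0.
  - rewrite [X in `|X|](_ : _ = - (val A 1 0 * val A 1 1)) ?normrN //.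
    by move: detA => /=; lra.
  - rewrite [X in `|X|](_ : _ = - (val A 1 0 ^+ 2)).
      by rewrite normrN ger0_norm ?sqr_ge0 // lerDl sqr_ge0.
    by move: detA => /=; lra.
  - rewrite [X in `|X|](_ : _ = val A 1 1 ^+ 2).
      by rewrite ger0_norm ?sqr_ge0 // lerDr sqr_ge0.
    by move: detA => /=; lra.
  - rewrite [X in `|X|](_ : _ = val A 1 0 * val A 1 1) //.
    by move: detA => /=; lra.
rewrite piB => /(congr1 (fun x => sigma^-1 * g * x * g^-1 * sigma)%g).
rewrite !mulgA mulg1 !mulgK !mulgVK mulVg mul1g mulr1z.
exact: unip1_neq1.
Qed.

Let D := coset_space (stab Gamma c) Gamma.

(* The matrix of [sigma^-1 g], translated so that the image of 'i has real
   part in [0, 1). *)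
Let reduced (g : PSL2 R) : SL2 R :=
  let A := repr (sigma^-1 * g)%g in
  (mkSL2 (unip_subproof (- (Num.floor (reI A))%:~R)) * A)%g.

Let bottom_reduced g i : val (reduced g) 1 i = val (repr (sigma^-1 * g)%g) 1 i.
Proof. by rewrite SL2_mulE !mxE /= mul0r add0r mul1r. Qed.

Let bottom2_reduced g : bottom2 (reduced g) = bottom_coset g.
Proof. by rewrite /bottom2 !bottom_reduced. Qed.

Let reI_reduced g : 0 <= reI (reduced g) < 1.
Proof.
have -> : reI (reduced g) = reI (repr (sigma^-1 * g)%g) -
    (Num.floor (reI (repr (sigma^-1 * g)%g)))%:~R.
  rewrite {1}/reI bottom2_reduced !bottom_reduced /reduced !SL2_mulE !mxE /=.
  rewrite !mul1r; set x := _%:~R; set A := repr _; rewrite /bottom_coset -/A.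
  have A0 : bottom2 A != 0 by rewrite gt_eqF ?bottom2_gt0.
  by apply: (mulIf A0); rewrite mulfVK // mulrBl mulfVK // /bottom2 /=; ring.
have /andP[] := floor_itv (reI (repr (sigma^-1 * g)%g)); rewrite intrD; lra.
Qed.

(** Integer translations are conjugate by [sigma] to stabiliser elements, so the reduction only
    changes [g] within its coset. *)
Let pi_reduced g : exists2 p, stab Gamma c p &
  \pi_(PSL2 R)%qT (reduced g) = (sigma^-1 * (p * g))%g.
Proof.
set n := - Num.floor (reI (repr (sigma^-1 * g)%g)).
exists (sigma * unip n%:~R * sigma^-1)%g; first exact: stab_unip.
rewrite /reduced PSL2_pi_mul reprK -intrN -/n -/(unip _).
by rewrite !mulgA mulVg mul1g.
Qed.

(** In the quotient of the two reduced matrices [sigma] cancels and leaves an element of [Gamma];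
    being close to 1 it equals 1, so the translated representatives coincide. *)
Lemma reduced_close_eq (delta : R) A1 A2 :
  (forall B : SL2 R, Gamma (\pi_(PSL2 R)%qT B) ->
    (forall i j, `|val B i j - (i == j)%:R| < delta) -> \pi_(PSL2 R)%qT B = 1%g) ->
  D A1 -> D A2 ->
  (forall i j, `|val ((reduced (coset_repr A1))^-1 *
     reduced (coset_repr A2))%g i j - (i == j)%:R| < delta) -> A1 = A2.
Proof.
move=> disc /coset_reprP[Gg1 E1] /coset_reprP[Gg2 E2] close.
have [p1 s1 pi1] := pi_reduced (coset_repr A1).
have [p2 s2 pi2] := pi_reduced (coset_repr A2).
set h := (_ * _)%g in close.
have piE : \pi_(PSL2 R)%qT h =
    ((coset_repr A1)^-1 * p1^-1 * p2 * coset_repr A2)%g.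
  by rewrite /h PSL2_pi_mul PSL2_pi_inv pi1 pi2 !invgM invgK !mulgA mulgK.
have : \pi_(PSL2 R)%qT h = 1%g.
  apply: disc => //; rewrite piE; apply: GammaM => //.
  apply: GammaM; last exact: s2.1.
  by apply: GammaM; apply: GammaV => //; exact: s1.1.
rewrite piE.
move=> /(congr1 (fun x => p1 * coset_repr A1 * x)%g).
rewrite mulg1 !mulgA mulgK mulgV mul1g => eq12.
by rewrite -E1 -E2 -(right_coset_mul _ s1) -eq12 right_coset_mul.
Qed.

(** A coset of level [k] is labelled by the box of its reduced matrix in scaled Iwasawa coordinates,
    and cosets sharing a box coincide. Only the real part needs a number of boxes growing like
    [4^k]; the bottom row needs a fixed number. *)
Lemma cusp_level_sums : exists (delta : R) (lev : set (PSL2 R) -> nat),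
  [/\ 0 < delta,
      forall A, D A -> delta * 4 ^+ lev A <= bottom_coset (coset_repr A) &
      forall t : R, 0 <= t -> 4 * t < 1 -> exists B : R,
        forall F, finite_set F -> F `<=` D ->
          \sum_(A \in F) t ^+ lev A <= B].
Proof.
have [delta delta0 disc] := fuchsian_discrete Gamma_fuchsian.
have /choice[lev levP] : forall A, exists k : nat, D A ->
    delta * 4 ^+ k <= bottom_coset (coset_repr A) <= delta * 4 ^+ k.+1.
  move=> A; have [DA|nDA] := pselect (D A); last by exists 0%N.
  have [k kP] := exists_level delta0
    (bottom_coset_ge disc (coset_reprP DA).1).
  by exists k.
exists delta, lev; split=> // [A /levP/andP[]//|t t0 t1].
(* Any divisor above 40 would give [40 * eta < delta]; the same 50 reappears in the mesh of [lx]. *)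
pose eta := delta / 50.
have eta0 : 0 < eta by rewrite divr_gt0.
pose Q := (Num.truncn (4 / eta)).+1.
have QP : 4 / eta <= Q%:R.
  by have /andP[_ /ltW] := truncn_itv (divr_ge0 (ler0n R 4) (ltW eta0)).
exists ((51 * Q.+1 ^ 2)%:R / (1 - 4 * t)); apply: (level_sum_le _ t0 t1) => k.
(* On level [k] the squared length of the bottom row lies between [q^2] and [4 q^2]. *)
pose q := Num.sqrt (delta * 4 ^+ k).
have q2 : q ^+ 2 = delta * 4 ^+ k.
  by rewrite sqr_sqrtr // mulr_ge0 ?exprn_ge0 // ltW.
have q0 : 0 < q by rewrite sqrtr_gt0 mulr_gt0 // exprn_gt0.
pose red A := reduced (coset_repr A).
(* A unit step of [lx] is a step [1 / (50 * 4^k)] of the real part, which [q^2] scales to [eta]. In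
   [lc], scaled entries from [[-2, 2]] are shifted to [[0, 4]] and cut into pieces of length
   [eta]. *)
pose lx A : R := (50 * 4 ^ k)%:R * reI (red A).
pose lc A i : R := (val (red A) 1 i / q + 2) / eta.
pose lab A : 'I_(50 * 4 ^ k).+1 * 'I_Q.+1 * 'I_Q.+1 :=
  (inord (Num.truncn (lx A)), inord (Num.truncn (lc A 0)),
   inord (Num.truncn (lc A 1))).
exists ('I_(50 * 4 ^ k).+1 * 'I_Q.+1 * 'I_Q.+1)%type, lab; split.
  rewrite !card_prod !card_ord -mulnA mulnn mulnAC leq_mul2r; apply/orP; right.
  by rewrite (mulnDl 50 1) mul1n -addn1 leq_add2l expn_gt0.
move=> A1 A2 D1 D2 k1 k2 [ex ec ed].
have rk A : D A -> lev A = k -> q ^+ 2 <= bottom2 (red A) <= 4 * q ^+ 2.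
  move=> /levP + levA; rewrite levA bottom2_reduced q2 exprS.
  by rewrite (mulrCA delta 4).
have lx_in A : 0 <= lx A <= (50 * 4 ^ k)%:R.
  have /andP[x0 /ltW x1] := reI_reduced (coset_repr A).
  by rewrite mulr_ge0 //= -[leRHS]mulr1 ler_wpM2l.
have lc_in A (i : 'I_2) : D A -> lev A = k -> 0 <= lc A i <= Q%:R.
  move=> DA levA; have /andP[_ r4] := rk A DA levA.
  have : `|val (red A) 1 i / q| <= 2.
    rewrite normrM normfV (gtr0_norm q0) ler_pdivrMr //.
    rewrite -(@ler_pXn2r _ 2) ?nnegrE ?mulr_ge0 ?(ltW q0) //.
    rewrite real_normK ?num_real // exprMn -natrX.
    apply: le_trans r4; rewrite /bottom2.
    have [->|->] : i = 0 \/ i = 1.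
      by case: (unliftP 0 i) => [i'|] ->; rewrite ?[i']ord1; [right|left];
        exact: val_inj.
      by rewrite lerDl sqr_ge0.
    by rewrite lerDr sqr_ge0.
  rewrite ler_norml => h; apply/andP; split.
    by rewrite divr_ge0 ?(ltW eta0) //; lra.
  by apply: le_trans QP; rewrite ler_pM2r ?invr_gt0 //; lra.
apply: (reduced_close_eq disc D1 D2) => i j.
apply: (@le_lt_trans _ _ (40 * eta)); last by rewrite /eta; lra.
apply: (same_box_close q0 (rk _ D1 k1) (rk _ D2 k2)).
- have := inord_truncn_dist (lx_in A1) (lx_in A2) ex.
  rewrite /lx -mulrBr normrM distrC ger0_norm // => h.
  rewrite q2 normrM gtr0_norm ?mulr_gt0 ?exprn_gt0 //.
  rewrite natrM natrX in h.
  rewrite [leLHS](_ : _ = eta * (50 * 4 ^+ k * `|reI (red A2) - reI (red A1)|)).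
    by rewrite ger_pMr.
  by rewrite /eta; field.
- have := inord_truncn_dist (lc_in _ _ D2 k2) (lc_in _ _ D1 k1) (esym ec).
  rewrite /lc -mulrBl normrM normfV (gtr0_norm eta0) ler_pdivrMr // mul1r.
  by rewrite opprD addrACA subrr addr0.
- have := inord_truncn_dist (lc_in _ _ D2 k2) (lc_in _ _ D1 k1) (esym ed).
  rewrite /lc -mulrBl normrM normfV (gtr0_norm eta0) ler_pdivrMr // mul1r.
  by rewrite opprD addrACA subrr addr0.
Qed.

End CuspCosets.

(** * Bounds on compact sets *)

Section ComplexBounds.
Context {R : realType}.

Lemma Re_continuous : continuous (@complex.Re R : R[i]^o -> R).
Proof.
move=> z; apply/(@cvgrPdist_lt _ _ _ _ (nbhs_filter z)) => e e0.
apply/(@nbhs_ballP R[i] R[i]^o); exists (e%:C)%C => [|w]; first by rewrite /= ltcR.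
rewrite -(@ball_normE R[i] R[i]^o) /ball_ /= => zw; rewrite -ltcR.
by apply: le_lt_trans zw; have := normc_ge_Re (z - w); rewrite raddfB.
Qed.

Lemma normc_ge_Im (z : R[i]) : (`|complex.Im z|%:C)%C <= `|z|.
Proof.
case: z => a b; rewrite [leRHS]/Num.norm /= lecR -sqrtr_sqr ler_wsqrtr //.
by rewrite lerDr sqr_ge0.
Qed.

Lemma Im_continuous : continuous (@complex.Im R : R[i]^o -> R).
Proof.
move=> z; apply/(@cvgrPdist_lt _ _ _ _ (nbhs_filter z)) => e e0.
apply/(@nbhs_ballP R[i] R[i]^o); exists (e%:C)%C => [|w]; first by rewrite /= ltcR.
rewrite -(@ball_normE R[i] R[i]^o) /ball_ /= => zw; rewrite -ltcR.
by apply: le_lt_trans zw; have := normc_ge_Im (z - w); rewrite raddfB.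
Qed.

Lemma compact_norm_le (T : topologicalType) (f : T -> R) (K : set T) :
  compact K -> {within K, continuous f} ->
  exists2 M, 0 <= M & forall x, K x -> `|f x| <= M.
Proof.
move=> cK cf; have [M [_ hM]] := compact_bounded (continuous_compact cf cK).
exists (`|M| + 1) => [|x Kx]; first by rewrite addr_ge0.
by apply: (hM (`|M| + 1)); [have := ler_norm M; lra | exists x].
Qed.

(** The minimum, being attained, leaves a gap above [a]; for empty [K] any value above [a]
    serves. *)
Lemma compact_gt_ge (T : topologicalType) (f : T -> R) (K : set T) (a : R) :
  compact K -> {within K, continuous f} -> (forall x, K x -> a < f x) ->
  exists2 m, a < m & forall x, K x -> m <= f x.
Proof.
move=> cK cf fa; have [K0|nK] := pselect (K !=set0).
  have [x /set_mem Kx xmin] := compact_EVT_min K0 cK cf.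
  by exists (f x) => [|y Ky]; [exact: fa | exact/xmin/mem_set].
by exists (a + 1) => [|x Kx]; [lra | case: nK; exists x].
Qed.

Lemma Im_SL2_act (A : SL2 R) (z : R[i]) : complex.Im (SL2_actC A z) =
  complex.Im z / ((val A 1 0 * complex.Re z + val A 1 1) ^+ 2 +
                  (val A 1 0 * complex.Im z) ^+ 2).
Proof.
have := SL2_det A; rewrite /SL2_actC; case: z => x y /=.
move: (sval A 0 0) (sval A 0 1) (sval A 1 0) (sval A 1 1) => a b c d detA.
rewrite !mul0r !addr0 !subr0 ?add0r; set n := (_ + _ ^+ 2)^-1.
transitivity (y * (a * d - b * c) * n); last by rewrite detA mulr1.
by ring.
Qed.

(** The denominator [|cz + d|^2] is comparable to [c^2 + d^2], uniformly for [z] in a bounded region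
    away from the real axis. *)
Lemma Im_SL2_act_bounds (X m : R) : 0 < m -> exists p M : R,
  [/\ 0 < p, 0 < M &
  forall (A : SL2 R) (z : R[i]), `|complex.Re z| <= X -> m <= complex.Im z <= X ->
    p / bottom2 A <= complex.Im (SL2_actC A z) <= M / bottom2 A].
Proof.
(* [L] comes from [d^2 <= 2 (cx + d)^2 + 2 c^2 x^2] together with [c^2 <= (cy)^2 / m^2]; [Y] is a
   positive bound for both coordinates. *)
move=> m0; pose Y := `|X| + 1; pose L := 2 + (1 + 2 * Y ^+ 2) / m ^+ 2.
have Y0 : 0 < Y by rewrite ltr_wpDl.
have m2 : 0 < m ^+ 2 by rewrite exprn_gt0.
have Y2 : 0 < Y ^+ 2 by rewrite exprn_gt0.
have L0 : 0 < L by rewrite addr_gt0 // divr_gt0 //; lra.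
exists (m / (3 * Y ^+ 2 + 2)), (Y * L); split.
- by rewrite divr_gt0 //; lra.
- exact: mulr_gt0.
move=> A z hx /andP[my hy]; rewrite Im_SL2_act.
have XY : X <= Y by have := ler_norm X; rewrite /Y; lra.
have x2 : complex.Re z ^+ 2 <= Y ^+ 2.
  rewrite -(real_normK (num_real (complex.Re z))).
  by rewrite ler_pXn2r ?nnegrE // ?(ltW Y0) // (le_trans hx).
have y0 : 0 < complex.Im z := lt_le_trans m0 my.
have y2 : complex.Im z ^+ 2 <= Y ^+ 2.
  by rewrite ler_pXn2r ?nnegrE ?ltW // (le_lt_trans hy) //; rewrite /Y;
    have := ler_norm X; lra.
have y2m : m ^+ 2 <= complex.Im z ^+ 2 by rewrite ler_pXn2r ?nnegrE ?(ltW m0) ?(ltW y0).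
have r0 := bottom2_gt0 A; rewrite /bottom2 in r0 *.
move: (complex.Re z) (complex.Im z) x2 y0 y2 y2m my hy {hx} => x y x2 y0 y2 y2m my hy.
move: (val A 1 0) (val A 1 1) r0 => c d r0.
set den := _ + (c * y) ^+ 2.
have c2x : c ^+ 2 * x ^+ 2 <= c ^+ 2 * Y ^+ 2 by rewrite ler_wpM2l ?sqr_ge0.
have c2y : c ^+ 2 * y ^+ 2 <= c ^+ 2 * Y ^+ 2 by rewrite ler_wpM2l ?sqr_ge0.
have c2m : c ^+ 2 * m ^+ 2 <= c ^+ 2 * y ^+ 2 by rewrite ler_wpM2l ?sqr_ge0.
have hsq : 0 <= (c * x + d) ^+ 2 by rewrite sqr_ge0.
have rL : c ^+ 2 + d ^+ 2 <= L * den.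
  have h1 : d ^+ 2 <= 2 * (c * x + d) ^+ 2 + 2 * (c ^+ 2 * x ^+ 2).
    by have := sqr_ge0 (2 * (c * x) + d); lra.
  have h2 : c ^+ 2 * (1 + 2 * Y ^+ 2) <= (1 + 2 * Y ^+ 2) / m ^+ 2 * (c * y) ^+ 2.
    rewrite mulrC -mulrA; apply: ler_wpM2l; first by lra.
    by rewrite mulrC ler_pdivlMr // exprMn.
  have h3 : 0 <= (1 + 2 * Y ^+ 2) / m ^+ 2 * (c * x + d) ^+ 2.
    by rewrite mulr_ge0 // divr_ge0 ?(ltW m2) //; lra.
  by have := sqr_ge0 (c * y); rewrite /L /den; lra.
have den0 : 0 < den by rewrite -(pmulr_rgt0 _ L0); apply: lt_le_trans rL.
have denY : den <= (3 * Y ^+ 2 + 2) * (c ^+ 2 + d ^+ 2).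
  have := sqr_ge0 (c * x - d); have := mulr_ge0 (ltW Y2) (sqr_ge0 d).
  by have := sqr_ge0 c; rewrite /den; lra.
apply/andP; split.
  rewrite -mulrA -invfM; apply: ler_pM => //; first exact: ltW.
    by rewrite invr_ge0 mulr_ge0 ?(ltW r0) //; lra.
  by rewrite lef_pV2 // posrE mulr_gt0 //; lra.
rewrite -mulrA; apply: ler_pM; [exact: ltW | by rewrite invr_ge0 ltW | lra |].
by rewrite ler_pdivlMr // mulrC ler_pdivrMr.
Qed.

Lemma normc_cpow (y : R) (s : R[i]) :
  Normc.normc (cpow y s) = y `^ complex.Re s.
Proof.
rewrite /cpow Normc.normcM normc_real /= cos2Dsin2 sqrtr1 mulr1.
by rewrite ger0_norm ?powR_ge0.
Qed.

(** Since [M >= 1] and [4^-k <= 1], the worst exponents are [a1] for the first factor and [a0] for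
    the second. *)
Lemma powR_le_geometric (y M a0 a1 a : R) (k : nat) : 0 < y -> 1 <= M ->
  y <= M / 4 ^+ k -> 0 <= a0 -> a0 <= a <= a1 ->
  y `^ a <= M `^ a1 * ((4^-1) `^ a0) ^+ k.
Proof.
move=> y0 M1 yM a00 /andP[a0a aa1].
have u0 : 0 < (4 ^+ k)^-1 :> R by rewrite invr_gt0 exprn_gt0.
have M0 : 0 <= M by lra.
apply: (@le_trans _ _ ((M / 4 ^+ k) `^ a)).
  apply: ge0_ler_powR => //; [lra | exact: ltW |].
  by rewrite nnegrE mulr_ge0 // ltW.
rewrite powRM ?(ltW u0) //; apply: ler_pM; rewrite ?powR_ge0 //.
  exact: ler_powR.
apply: (@le_trans _ _ ((4 ^+ k)^-1 `^ a0)).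
  apply: ger_powR => //; rewrite u0 invf_le1 ?exprn_gt0 //.
  by rewrite exprn_ege1 // ler1n.
rewrite -exprVn -!powR_mulrn ?powR_ge0 ?invr_ge0 // -!powRrM.
by rewrite mulrC.
Qed.

(** The ratio is [4^(1 - a)]: here an exponent above 1 beats the growth [4^k] of the levels. *)
Lemma powR4_lt1 (a : R) : 1 < a -> 4 * (4^-1) `^ a < 1.
Proof.
move=> a1; rewrite -(subrK 1 a) addrC powRD; last first.
  by rewrite invr_eq0 pnatr_eq0 implybT.
rewrite powRr1 ?invr_ge0 // mulrA mulfV ?pnatr_eq0 // mul1r.
have a10 : 0 < a - 1 by rewrite subr_gt0.
have := gt0_ltr_powR a10 (x := 4^-1) (y := 1); rewrite powR1; apply.
- by rewrite nnegrE invr_ge0.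
- by rewrite nnegrE.
- by lra.
Qed.

(** A single constant serves both signs of the exponent, as both summands are nonnegative. *)
Lemma powR_pm_le (y p M a : R) : 0 < p -> p <= y <= M -> 0 <= a ->
  y `^ a <= M `^ a + (p `^ a)^-1 /\ y `^ (- a) <= M `^ a + (p `^ a)^-1.
Proof.
move=> p0 /andP[py yM] a0; have y0 := lt_le_trans p0 py.
have pa : 0 < p `^ a by exact: powR_gt0.
have h1 : y `^ a <= M `^ a.
  by apply: ge0_ler_powR; rewrite ?nnegrE //; lra.
have h2 : (y `^ a)^-1 <= (p `^ a)^-1.
  rewrite lef_pV2 ?posrE ?powR_gt0 //.
  by apply: ge0_ler_powR; rewrite ?nnegrE //; lra.
rewrite powRN; have := powR_ge0 M a; have : 0 < (p `^ a)^-1 by rewrite invr_gt0.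
by split; lra.
Qed.

End ComplexBounds.

(** * Locally uniform domination of the twisted Eisenstein series *)

Theorem corollaryC
  (R : realType)
  (Gamma : set (PSL2 R))
  (Gamma_fuchsian : fuchsian Gamma)
  (Gamma_geomfin : geometrically_finite Gamma)
  (Gamma_cusp : cusp_rep Gamma !=set0)
  (V : vectType R[i])
  (dot : {dot V for Num.conj})
  (N : 'End(V) -> R)
  (N_norm : is_norm N)
  (chi : PSL2 R -> 'End(V))
  (chi_repr : representation Gamma chi)
  (chi_nonexp : nonexpanding_cusp_monodromy Gamma chi)
  (CC : set (Rhat R))
  (CC_transversal : cusp_transversal Gamma CC)
  (sigma : Rhat R -> PSL2 R)
  (sigma_scaling : forall c, CC c -> cusp_scaling Gamma c (sigma c))
  (P : Rhat R -> 'End(V))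
  (P_proj : forall c, CC c ->
     orthogonal_projection dot (cusp_fixed Gamma chi c) (P c))
  (Cexp : Rhat R -> R)
  (Cexp_admissible : forall c, CC c ->
     admissible_exponent N Gamma chi c (sigma c) (P c) (Cexp c))
  (C : R)
  (C_max : is_max [set Cexp c | c in CC] C) :
  forall c, CC c ->
    cvg_absolutely_compactly N (coset_space (stab Gamma c) Gamma)
      (eisenstein_term chi (sigma c) (P c))
      [set zs : R[i]^o * R[i]^o | uhp zs.1 /\ 1 + C < complex.Re zs.2].
Proof.
move=> c Cc; apply: weierstrass_Mtest => // K cK KX.
have [a_gt0 [b [He [b_cont _ He_fin adm]]]] := Cexp_admissible c Cc.
have a_le : Cexp c <= C by apply: C_max.2; exists c.
set a := Cexp c in a_gt0 a_le adm.
have fst_cont : continuous (fst : R[i]^o * R[i]^o -> R[i]^o) by move=> x; exact: cvg_fst.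
have snd_cont : continuous (snd : R[i]^o * R[i]^o -> R[i]^o) by move=> x; exact: cvg_snd.
have Re1_cont : {within K, continuous (fun zs => complex.Re zs.1)}.
  by apply: continuous_subspaceT => x; apply: continuous_comp;
    [exact: fst_cont | exact: Re_continuous].
have Im1_cont : {within K, continuous (fun zs => complex.Im zs.1)}.
  by apply: continuous_subspaceT => x; apply: continuous_comp;
    [exact: fst_cont | exact: Im_continuous].
have Re2_cont : {within K, continuous (fun zs => complex.Re zs.2)}.
  by apply: continuous_subspaceT => x; apply: continuous_comp;
    [exact: snd_cont | exact: Re_continuous].
have [X1 X1_ge0 X1P] := compact_norm_le cK Re1_cont.
have [X2 X2_ge0 X2P] := compact_norm_le cK Im1_cont.
have [S S_ge0 SP] := compact_norm_le cK Re2_cont.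
have [|m m_gt0 mP] := @compact_gt_ge _ _ _ _ 0 cK Im1_cont.
  by move=> zs /KX[].
have [|r r_gt rP] := @compact_gt_ge _ _ _ _ (1 + C) cK Re2_cont.
  by move=> zs /KX[].
(* The function [b] and the exceptional sets depend on [z] alone, so they are controlled on the
   projection of [K]. *)
pose K1 := [set zs.1 | zs in K].
have cK1 : compact K1.
  exact: (continuous_compact (continuous_subspaceT (A := K) fst_cont) cK).
have K1_uhp : K1 `<=` @uhp R by move=> _ [zs /KX[? _] <-].
have [b1 b1_ge0 b1P] := compact_norm_le cK1 (continuous_subspaceW K1_uhp b_cont).
have [p [M [p_gt0 M_gt0 actP]]] := @Im_SL2_act_bounds R (X1 + X2) m m_gt0.
have [delta [lev [delta_gt0 levP lev_sum]]] :=
  cusp_level_sums Gamma_fuchsian (sigma_scaling c Cc).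
have zK zs : K zs -> `|complex.Re zs.1| <= X1 + X2 /\
    m <= complex.Im zs.1 <= X1 + X2.
  move=> Kzs; have := X1P _ Kzs; have := X2P _ Kzs; have := mP _ Kzs.
  by have := ler_norm (complex.Im zs.1); split; [|apply/andP; split]; lra.
pose r0 := bottom2 (repr (sigma c)^-1%g).
have r0_gt0 : 0 < r0 by exact: bottom2_gt0.
(* On [K], [Im(sigma^-1.z)] lies between [p / r0] and [M / r0]; [W0] bounds its power for either
   sign [e]. *)
pose W0 := (M / r0) `^ a + ((p / r0) `^ a)^-1.
(* The added 1 secures the hypothesis [1 <= M] of [powR_le_geometric]. *)
pose M1 := 1 + M / delta.
have M1_ge1 : 1 <= M1 by rewrite lerDl divr_ge0 ?ltW.
(* [r - C > 1] gives [4 * t < 1]; as [a <= C], it is also a lower bound for the total exponent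
   [Re s + e * a] on [K]. *)
pose t : R := (4^-1) `^ (r - C).
pose W := b1 * W0 * M1 `^ (S + a).
have W0_ge0 : 0 <= W0.
  by rewrite addr_ge0 ?invr_ge0 ?powR_ge0.
have W_ge0 : 0 <= W by rewrite !mulr_ge0 ?powR_ge0.
have [|B BP] := lev_sum t (powR_ge0 _ _).
  by apply: powR4_lt1; rewrite ltrBrDr.
exists (\bigcup_(z in K1) He z), (fun A => W * t ^+ lev A), (W * B); split.
- exact: He_fin.
- by move=> A; rewrite mulr_ge0 ?exprn_ge0 ?powR_ge0.
- by move=> F finF FD; rewrite -mulr_fsumr ler_wpM2l // BP.
move=> A zs DA nHe Kzs.
have [Gg gA] := coset_reprP Gamma_fuchsian (sigma_scaling c Cc) DA.
have [zs_uhp _] := KX _ Kzs.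
have nHez : ~ He zs.1 (right_coset (stab Gamma c) (coset_repr A)).
  by rewrite gA => HA; apply: nHe; exists zs.1 => //; exists zs.
have := adm _ zs_uhp _ Gg nHez; have lev_le := levP _ DA.
rewrite /eisenstein_term /eisenstein_summand.
set g := coset_repr A in lev_le *.
case: (N_norm) => _ NZ _; rewrite NZ normc_cpow.
have [hx hy] := zK _ Kzs.
have y0P := actP (repr (sigma c)^-1%g) _ hx hy.
have y1P := actP (repr ((sigma c)^-1 * g)%g) _ hx hy.
rewrite /=; set y0 := complex.Im (actC (sigma c)^-1%g zs.1).
set y1 := complex.Im (actC _ zs.1); set e : R := if _ then _ else _.
have y1_gt0 : 0 < y1.
  by apply: lt_le_trans (proj1 (andP y1P)); rewrite divr_gt0 ?bottom2_gt0.
have y1_le : y1 <= M1 / 4 ^+ lev A.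
  apply: le_trans (proj2 (andP y1P)) _.
  apply: (@le_trans _ _ (M / (delta * 4 ^+ lev A))).
    rewrite ler_pM2l // lef_pV2 ?posrE ?bottom2_gt0 //.
    by rewrite mulr_gt0 ?exprn_gt0.
  rewrite invfM mulrA ler_pM2r ?invr_gt0 ?exprn_gt0 //.
  by rewrite /M1 lerDr.
have y0_pow : y0 `^ (- (e * a)) <= W0.
  have [h1 h2] := powR_pm_le (divr_gt0 p_gt0 r0_gt0) y0P (ltW a_gt0).
  by rewrite /e; case: ifP => _; rewrite ?mul1r // mulN1r opprK.
have y1_pow : y1 `^ (complex.Re zs.2 + e * a) <= M1 `^ (S + a) * t ^+ lev A.
  have Rs_le := le_trans (ler_norm _) (SP _ Kzs); have Rs_ge := rP _ Kzs.
  have ea : `|e * a| <= a.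
    by rewrite normrM (gtr0_norm a_gt0) /e; case: ifP;
      rewrite ?normrN normr1 mul1r.
  move: ea; rewrite ler_norml => /andP[ea_ge ea_le].
  apply: powR_le_geometric => //; first by rewrite subr_ge0; move: r_gt; clear; lra.
  rewrite [X in _ && X]lerD // andbT.
  by move: Rs_ge ea_ge a_le; clear; lra.
move=> Nle; apply: le_trans (ler_wpM2l (powR_ge0 _ _) Nle) _.
have b_le : b zs.1 <= b1 by apply: le_trans (ler_norm _) (b1P _ _); exists zs.
have b_y0 : b zs.1 * y0 `^ (- (e * a)) <= b1 * W0.
  apply: le_trans (ler_wpM2r (powR_ge0 _ _) b_le) _.
  exact: ler_wpM2l.
(* The factor [y1] to the power [Re s] from the series merges with its power [e * a] from the
   admissible bound. *)
rewrite mulrCA -powRD; last by rewrite (gt_eqF y1_gt0) implybT.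
apply: le_trans (ler_wpM2r (powR_ge0 _ _) b_y0) _.
by rewrite /W -[leRHS]mulrA; apply: ler_wpM2l => //; exact: mulr_ge0.
Qed.
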